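(* Let $(V,\mathcal{B})$ be a standard Borel space, let $\Delta\in\mathbb{N}$, let $\mathcal{G}=(V,\mathcal{B},E)$ be a Borel graph in which every vertex has degree at most $\Delta$, and let $\mu$ be a Borel probability measure on $(V,\mathcal{B})$ that is $\mathcal{G}$-quasi-invariant. Then there is a Borel probability measure $\nu$ on $(V,\mathcal{B})$, equivalent to $\mu$, such that $$\frac{1}{4\Delta}\le \rho_\nu(x,y)\le 4\Delta$$ for every edge $(x,y)\in E$, where $\rho_\nu$ is the Radon--Nikodym cocycle of $\nu$ with respect to $\mathcal{G}$. In particular, if $\operatorname{dist}_{\mathcal{G}}(x,y)=k\in\mathbb{N}$, then $\rho_\nu(x,y)\le(4\Delta)^k$.
   Context: A Borel graph $\mathcal{G}=(V,\mathcal{B},E)$ consists of a standard Borel space $(V,\mathcal{B})$ and a set $E$ of edges that is a Borel subset of $[V]^2$, the set of unordered pairs of distinct elements of $V$ with the Borel structure inherited from $V\times V$; $(x,y)\in E$ means that $\{x,y\}$ is an edge. $\operatorname{dist}_{\mathcal{G}}$ is the graph distance. $F_{\mathcal{G}}\subseteq V\times V$ is the equivalence relation of being in the same connected component of $\mathcal{G}$, and $[A]_{\mathcal{G}}$ is the union of all connected components meeting $A\subseteq V$. A Borel probability measure $\mu$ on $V$ is $\mathcal{G}$-quasi-invariant if $\mu([A]_{\mathcal{G}})=0$ whenever $\mu(A)=0$. Two Borel probability measures are equivalent if they have the same null sets (so a measure equivalent to a $\mathcal{G}$-quasi-invariant one is $\mathcal{G}$-quasi-invariant). The Radon--Nikodym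 cocycle of a $\mathcal{G}$-quasi-invariant Borel probability measure $\nu$ is a Borel function $\rho_\nu:F_{\mathcal{G}}\to(0,+\infty)$ such that $$\nu(g(C))=\int_C\rho_\nu(x,g(x))\,d\nu(x)$$ for every Borel $C\subseteq V$ and every injective Borel map $g:C\to V$ with $(x,g(x))\in F_{\mathcal{G}}$ for all $x\in C$. It exists and is unique up to null sets: any two such functions agree on $F_{\mathcal{G}}\cap(A\times A)$ for some $\nu$-conull $\mathcal{G}$-invariant Borel set $A$ (where $\mathcal{G}$-invariant means $[A]_{\mathcal{G}}=A$). Pointwise statements about $\rho_\nu$ are understood for a suitable version of the cocycle, equivalently for all relevant pairs of points inside some $\nu$-conull $\mathcal{G}$-invariant Borel set. *)

(* Defs.v *)
From mathcomp Require Import all_boot all_order all_algebra.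
From mathcomp Require Import all_classical all_reals all_analysis.

Set Implicit Arguments.
Unset Strict Implicit.
Unset Printing Implicit Defensive.

Import Order.TTheory GRing.Theory Num.Theory.

Local Open Scope classical_set_scope.
Local Open Scope ring_scope.

Definition complete_metric (R : realType) (P : metricType R) : Prop :=
  forall F : set_system P, ProperFilter F -> cauchy F -> exists p : P, F --> p.

Definition separable (P : topologicalType) : Prop :=
  exists2 D : set P, countable D & dense D.

(* [f] transports the Borel sets of a Polish space [P] to the measurable sets
   of [V]; the R-valued complete metric is part of the existential, so only
   the sigma-algebra of [V] is constrained. *)
Definition standard_borel (R : realType) (d : measure_display)
    (V : measurableType d) : Prop :=
  exists (P : metricType R) (f : V -> P),
    [/\ complete_metric P, separable P, bijective f &
        forall A : set V, measurable A <-> <<s @open P >> (f @` A)].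

Section graph.
Context (d : measure_display) (V : measurableType d).

(* A Borel set of unordered pairs of distinct points is encoded by its
   preimage in [V * V], a symmetric irreflexive measurable relation. *)
Definition borel_graph (E : set (V * V)) : Prop :=
  [/\ measurable E, forall x y, E (x, y) -> E (y, x) & forall x, ~ E (x, x)].

Definition neighbors (E : set (V * V)) (x : V) : set V := [set y | E (x, y)].

Definition max_degree_le (E : set (V * V)) (Delta : nat) : Prop :=
  forall x : V, (neighbors E x #<= `I_Delta)%card.

Fixpoint walk (E : set (V * V)) (k : nat) (x y : V) : Prop :=
  if k is k'.+1 then exists2 z, E (x, z) & walk E k' z y else x = y.

Definition component_rel (E : set (V * V)) : set (V * V) :=
  [set xy | exists k, walk E k xy.1 xy.2].

(* [dist_is E x y k] is false for every [k] when the distance is infinite. *)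
Definition dist_is (E : set (V * V)) (x y : V) (k : nat) : Prop :=
  walk E k x y /\ forall j, (j < k)%N -> ~ walk E j x y.

Definition saturation (E : set (V * V)) (A : set V) : set V :=
  [set y | exists2 x, A x & component_rel E (x, y)].

Context (R : realType).

(* [negligible] (contained in a measurable null set) avoids evaluating [mu] at
   a saturation not yet known to be measurable, where its value would be
   arbitrary; on measurable sets it means [mu (saturation E A) = 0]. *)
Definition quasi_invariant (E : set (V * V)) (mu : probability V R) : Prop :=
  forall A : set V, measurable A -> mu A = 0%E ->
    mu.-negligible (saturation E A).

Definition equivalent_measures (mu nu : probability V R) : Prop :=
  forall A : set V, measurable A -> mu A = 0%E <-> nu A = 0%E.

(* [rho] is only constrained on [component_rel E], and a Borel map [C -> V] is
   given by a total function of which only the restriction to [C] matters.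
   Measurability of the domain is explicit because [measurable_fun] holds
   vacuously on a non-measurable domain. *)
Definition RN_cocycle (E : set (V * V)) (nu : probability V R)
    (rho : V * V -> R) : Prop :=
  [/\ measurable (component_rel E),
      measurable_fun (component_rel E) rho,
      forall xy, component_rel E xy -> 0 < rho xy &
      forall (C : set V) (g : V -> V),
        measurable C -> measurable_fun C g -> set_inj C g ->
        (forall x, C x -> component_rel E (x, g x)) ->
        (nu (g @` C) = \int[nu]_(x in C) (rho (x, g x))%:E)%E].

End graph.

(* Main.v *)
Require Import Defs.
From HB Require Import structures.
From mathcomp Require Import all_boot all_order all_algebra.
From mathcomp Require Import all_classical all_reals all_analysis.
From mathcomp Require Import measurable_realfun lra.

Import Order.TTheory GRing.Theory Num.Theory.

Local Open Scope classical_set_scope.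
Local Open Scope ring_scope.

Set Implicit Arguments.
Unset Strict Implicit.

(** Write N(A) for the set of neighbours of A.  By the Lusin-Souslin theorem,
    E is a union of the graphs of Delta Borel partial functions f_i, and
    T lam = sum_i (f_i)_* lam satisfies lam(N(A)) <= (T lam)(A) <=
    Delta lam(N(A)).  The measure nu = sum_k (4 Delta)^-k T^k mu, once
    normalized, is equivalent to mu by quasi-invariance, and
    nu(N(A)) <= (T nu)(A) <= 4 Delta nu(A).  Iterating, a Borel partial
    injection g whose graph consists of pairs at distance k satisfies
    (4 Delta)^-k nu(A) <= nu(g(A)) <= (4 Delta)^k nu(A), hence has a
    Radon-Nikodym density with values in [(4 Delta)^-k, (4 Delta)^k].  As F_G
    is a countable disjoint union of such graphs, gluing the densities gives
    the cocycle. *)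

(** * Analytic sets *)

(** It suffices to find [nu] with T nu <= c nu, and summing the powers of T against a geometric
    weight forces this, because applying T only shifts the series and drops its first term. T
    multiplies the total mass by at most Delta, so any c above Delta gives convergence; c = 4 Delta
    leaves room to spare. Since E is symmetric, the single inequality for N(A) bounds nu(g(A)) from
    both sides.

    The obstacle is measurability: N(A), the ranges of partial injections and F_G are projections of
    Borel sets, which in general are merely analytic. Here all fibres involved are finite, so
    everything reduces to projections that are injective on a Borel set. These are handled through
    Lusin's separation theorem, with points coded by sequences of naturals.

    A second point is that a Radon-Nikodym density is determined only almost everywhere, whereas the
    bounds are claimed at every pair; the density is therefore truncated to the required
    interval. *)

Definition agree (n : nat) (a b : nat -> nat) : Prop :=
  forall i, (i < n)%N -> a i = b i.

Definition cylinder (s : seq nat) : set (nat -> nat) :=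
  [set a | forall i, (i < size s)%N -> a i = nth 0%N s i].

Definition baire_closed (F : set (nat -> nat)) : Prop :=
  forall a, (forall n, exists2 b, F b & agree n a b) -> F a.

(** [U] stands for a subbase, so continuity is tested on its members; no topology on [X] has to be
    formed. *)
Definition baire_continuous (X : Type) (U : nat -> set X)
    (phi : (nat -> nat) -> X) : Prop :=
  forall a j, U j (phi a) ->
    exists n, forall b, agree n a b -> U j (phi b).

Lemma agree_refl n a : agree n a a.
Proof. by []. Qed.

Lemma agree_leq m n a b : (m <= n)%N -> agree n a b -> agree m a b.
Proof. by move=> mn ab i im; apply: ab; exact: leq_trans mn. Qed.

Lemma agree_cylinder n a b : cylinder (mkseq a n) b <-> agree n a b.
Proof.
split=> [ab i ni|ab i].
  by rewrite ab ?size_mkseq// nth_mkseq.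
by rewrite size_mkseq => ni; rewrite nth_mkseq// -ab.
Qed.

Lemma cylinder_closed s : baire_closed (cylinder s).
Proof. by move=> a /(_ (size s))[b sb ab] i si; rewrite ab// sb. Qed.

(* [pp_open] is a countable subbase of a Polish topology generating the
   sigma-algebra of [X], [pp_point] a continuous surjection from Baire space
   and [pp_code] a measurable section of it. *)
Record polish_presentation (d : measure_display) (X : measurableType d) :=
  PolishPresentation {
  pp_open : nat -> set X ;
  pp_point : (nat -> nat) -> X ;
  pp_code : X -> nat -> nat ;
  pp_open_measurable : forall j, measurable (pp_open j) ;
  pp_generate : forall A, measurable A -> <<s range pp_open >> A ;
  pp_hausdorff : forall x y, x <> y ->
    exists i j, [/\ pp_open i x, pp_open j y & pp_open i `&` pp_open j = set0] ;
  pp_point_continuous : baire_continuous pp_open pp_point ;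
  pp_code_measurable : forall n k, measurable [set x | pp_code x n = k] ;
  pp_codeK : forall x, pp_point (pp_code x) = x }.

Arguments pp_generate {d X} p [A].
Arguments pp_hausdorff {d X} p [x y].
Arguments pp_point_continuous {d X} p [a j].
Arguments pp_open_measurable {d X} p j.
Arguments pp_code_measurable {d X} p n k.
Arguments pp_codeK {d X} p x.

Section analytic.
Context (X : Type) (U : nat -> set X).

(** Allowing any closed [F] as parameter set lets the empty set, cylinders and coincidence sets
    serve directly. *)
Definition analytic (A : set X) : Prop :=
  exists F phi, [/\ baire_closed F, baire_continuous U phi & A = phi @` F].

Definition shift (c : nat -> nat) : nat -> nat := fun i => c i.+1.

(** The entry [c 0] of a code selects the set, and the shifted code parametrizes a point of it. *)
Lemma analytic_bigcup (A : nat -> set X) :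
  (forall n, analytic (A n)) -> analytic (\bigcup_n A n).
Proof.
move=> /choice[F] /choice[phi FphiA].
exists [set c | F (c 0%N) (shift c)], (fun c => phi (c 0%N) (shift c)); split.
- move=> c cF /=; have [+ _ _] := FphiA (c 0%N); apply => n.
  have [b /= bF cb] := cF n.+1; exists (shift b).
    by rewrite (cb 0%N).
  by move=> i ni; exact: cb.
- move=> c j /= Ujc; have [_ /(_ _ _ Ujc)[n nU] _] := FphiA (c 0%N).
  exists n.+1 => b cb; rewrite -(cb 0%N)//; apply: nU => i ni.
  exact: cb.
- apply/seteqP; split=> [x [n _]|x /= [c cF <-]].
    have [_ _ ->] := FphiA n; case=> a aF <-.
    by exists (fun i => if i is i'.+1 then a i' else n).
  by exists (c 0%N) => //; have [_ _ ->] := FphiA (c 0%N); exists (shift c).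
Qed.

Definition unpair (n : nat) (c : nat -> nat) : nat -> nat :=
  fun k => c (pickle (n, k)).

Lemma agree_unpair n m : exists N, forall c b,
  agree N c b -> agree m (unpair n c) (unpair n b).
Proof.
exists (\max_(k < m) (pickle (n, (k : nat))).+1)%N => c b cb k km.
apply: cb; exact: (leq_bigmax (Ordinal km)).
Qed.

Lemma baire_continuous_unpair phi n :
  baire_continuous U phi -> baire_continuous U (phi \o unpair n).
Proof.
move=> cphi c j /cphi[m mU]; have [N NP] := agree_unpair n m.
by exists N => b /NP /mU.
Qed.

(** A point of the intersection is coded by one code for each [A n], all with the same image. The
    Hausdorff property makes this coincidence a closed condition. *)
Lemma analytic_bigcap (A : nat -> set X) :
  (forall x y, x <> y -> exists i j, [/\ U i x, U j y & U i `&` U j = set0]) ->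
  (forall n, analytic (A n)) -> analytic (\bigcap_n A n).
Proof.
move=> hausU /choice[F] /choice[phi FphiA].
exists [set c | forall n, F n (unpair n c) /\
                phi n (unpair n c) = phi 0%N (unpair 0 c)],
       (phi 0%N \o unpair 0); split.
- move=> c cF /= n; split.
    have [+ _ _] := FphiA n; apply => m.
    have [N NP] := agree_unpair n m; have [b /(_ n)[bF _] /NP cb] := cF N.
    by exists (unpair n b).
  apply: contrapT => /hausU[i [j [Ui Uj Uij0]]].
  have [_ /(baire_continuous_unpair (n := n)) /(_ _ _ Ui)[N1 NP1] _] := FphiA n.
  have [_ /(baire_continuous_unpair (n := 0%N)) /(_ _ _ Uj)[N2 NP2] _] := FphiA 0%N.
  have [b /(_ n)[_ be] cb] := cF (maxn N1 N2).
  have := NP1 _ (agree_leq (leq_maxl _ _) cb).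
  have := NP2 _ (agree_leq (leq_maxr _ _) cb).
  move=> /= U2; rewrite be => U1.
  by rewrite -[False]/(set0 (phi 0%N (unpair 0 b))) -Uij0.
- by apply: baire_continuous_unpair; have [] := FphiA 0%N.
- apply/seteqP; split=> [x Ax|x /= [c cF <-] n _].
    have /choice[a aP] : forall n, exists a, F n a /\ phi n a = x.
      move=> n; have [_ _ An] := FphiA n; have := Ax n I.
      by rewrite An => -[a aF aE]; exists a.
    (* Indices that encode no pair are never read by [unpair]; the value 0 there is arbitrary. *)
    pose c k := if unpickle k is Some (n, i) then a n i else 0%N.
    have cE n : unpair n c = a n.
      by apply/funext => k; rewrite /unpair /c pickleK.
    exists c => /=; last by rewrite cE; case: (aP 0%N).
    move=> n; rewrite !cE; have [? ->] := aP n; split=> //.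
    by have [_ ->] := aP 0%N.
  have [_ _ ->] := FphiA n; have [? <-] := cF n; by exists (unpair n c).
Qed.

End analytic.

(** The continuity hypothesis asks for one subbasic neighbourhood instead of a finite intersection;
    projections of a product satisfy it. *)
Lemma analytic_image (X Y : Type) (U : nat -> set X) (W : nat -> set Y)
    (f : X -> Y) (A : set X) :
  (forall x j, W j (f x) -> exists2 i, U i x & U i `<=` f @^-1` W j) ->
  analytic U A -> analytic W (f @` A).
Proof.
move=> fc [F [phi [cF cphi ->]]]; exists F, (f \o phi); split => //.
  move=> a j /= /fc[i Ui UW]; have [n nP] := cphi _ _ Ui.
  by exists n => b /nP /UW.
by rewrite image_comp.
Qed.

Section separation.
Context (d : measure_display) (X : measurableType d).

Definition separated_by_measurable (A B : set X) : Prop :=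
  exists S, [/\ measurable S, A `<=` S & B `&` S = set0].

Lemma separated_bigcup (A B : nat -> set X) :
  (forall n m, separated_by_measurable (A n) (B m)) ->
  separated_by_measurable (\bigcup_n A n) (\bigcup_n B n).
Proof.
move=> sepAB; have /choice[S SP] : forall n, exists S : nat -> set X, forall m,
    [/\ measurable (S m), A n `<=` S m & B m `&` S m = set0].
  by move=> n; have [S SP] := choice (sepAB n); exists S.
exists (\bigcup_n \bigcap_m S n m); split.
- apply: bigcupT_measurable => n; apply: bigcapT_measurable => m.
  by case: (SP n m).
- move=> x [n _ Anx]; exists n => // m _.
  by have [_ + _] := SP n m; exact.
- rewrite -subset0 => x [[m _ Bmx] [n _ /(_ m I) Sx]].
  by have [_ _ <-] := SP n m.
Qed.

(* If [phi @` F] and [psi @` G] were not separated, neither would be their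
   pieces along some pair of branches [a], [b]; but these pieces shrink to the
   distinct points [phi a] and [psi b]. *)
Lemma lusin_separation (U : nat -> set X) (A B : set X) :
  (forall j, measurable (U j)) ->
  (forall x y, x <> y -> exists i j, [/\ U i x, U j y & U i `&` U j = set0]) ->
  analytic U A -> analytic U B -> A `&` B = set0 ->
  separated_by_measurable A B.
Proof.
move=> mU hausU [F [phi [cF cphi AE]]] [G [psi [cG cpsi BE]]] AB0.
pose Q (st : seq nat * seq nat) := ~ separated_by_measurable
  (phi @` (F `&` cylinder st.1)) (psi @` (G `&` cylinder st.2)).
apply: contrapT => nsep.
have stepF (K : set (nat -> nat)) (chi : (nat -> nat) -> X) s :
    chi @` (K `&` cylinder s) =
    \bigcup_n chi @` (K `&` cylinder (rcons s n)).
  apply/seteqP; split=> [x [a [Ka sa] <-]|x [n _ [a [Ka sa] <-]]].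
    exists (a (size s)) => //; exists a => //; split => // i.
    rewrite size_rcons ltnS leq_eqVlt => /orP[/eqP ->|si].
      by rewrite nth_rcons ltnn eqxx.
    by rewrite nth_rcons si sa.
  exists a => //; split => // i si; rewrite sa ?size_rcons ?nth_rcons ?si//.
  exact: ltnW.
have step st : exists nm, Q st -> Q (rcons st.1 nm.1, rcons st.2 nm.2).
  have [Qst|] := pselect (Q st); last by exists (0%N, 0%N).
  apply: contrapT => /forallNP nQ; apply: Qst; rewrite !stepF.
  by apply: separated_bigcup => n m; have /not_implyP[_ /contrapT] := nQ (n, m).
have {step}[g gP] := choice step.
pose st := fix st n := if n is n'.+1 then
  (rcons (st n').1 (g (st n')).1, rcons (st n').2 (g (st n')).2) else ([::], [::]).
have Qst n : Q (st n).
  elim: n => [|n /gP//]; rewrite /Q/=; apply: contra_not nsep.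
  rewrite (_ : cylinder [::] = setT) ?setIT -?AE -?BE//.
  by apply/seteqP; split.
pose a n := (g (st n)).1; pose b n := (g (st n)).2.
have aE n : (st n).1 = mkseq a n.
  by elim: n => //= n ->; rewrite mkseqS.
have bE n : (st n).2 = mkseq b n.
  by elim: n => //= n ->; rewrite mkseqS.
(* If no point of [F] agreed with [a] up to [n], the first piece would be empty and [set0] would
   separate. For [b], the set [setT] plays this part. *)
have Fa : F a.
  apply: cF => n; apply: contrapT => nF; apply: (Qst n).
  exists set0; split => //; last by rewrite setI0.
  move=> x [c [Fc]]; rewrite aE => /agree_cylinder ac _; apply: nF.
  by exists c.
have Gb : G b.
  apply: cG => n; apply: contrapT => nG; apply: (Qst n).
  exists setT; split => //; rewrite setIT -subset0.
  move=> x [c [Gc]]; rewrite bE => /agree_cylinder bc _; apply: nG.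
  by exists c.
have /hausU[i [j [Ui Uj Uij]]] : phi a <> psi b.
  move=> ab; rewrite -[False]/(set0 (phi a)) -AB0; split.
    by rewrite AE; exists a.
  by rewrite ab BE; exists b.
have [n1 nP1] := cphi _ _ Ui; have [n2 nP2] := cpsi _ _ Uj.
apply: (Qst (maxn n1 n2)); exists (U i); split => //.
  move=> x [c [_]]; rewrite aE => /agree_cylinder ac <-.
  exact/nP1/(agree_leq (leq_maxl _ _) ac).
rewrite -subset0 => x [[c [_]]]; rewrite bE => /agree_cylinder bc <- Uic.
rewrite -Uij; split => //.
exact/nP2/(agree_leq (leq_maxr _ _) bc).
Qed.

End separation.

Section borel_analytic.
Context (d : measure_display) (X : measurableType d) (p : polish_presentation X).
Local Notation U := (pp_open p).
Local Notation L := (pp_point p).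

Lemma pp_preimage_open j (s : nat -> nat) : U j (L s) ->
  exists t, cylinder t s /\ L @` cylinder t `<=` U j.
Proof.
move=> /pp_point_continuous[n nP]; exists (mkseq s n); split.
  exact/agree_cylinder/agree_refl.
by move=> _ [b /agree_cylinder /nP ? <-].
Qed.

Lemma analytic_set0 : analytic U set0.
Proof.
exists set0, L; split => [a /(_ 0%N)[]//| |]; first exact: pp_point_continuous.
by rewrite image_set0.
Qed.

(** The preimage of [U j] in Baire space is open and need not be closed, so it is cut into countably
    many cylinders. *)
Lemma analytic_open j : analytic U (U j).
Proof.
pose A n := if unpickle n is Some s then
  [set x | L @` cylinder s `<=` U j /\ (L @` cylinder s) x] else set0.
have -> : U j = \bigcup_n A n.
  apply/seteqP; split=> [x|x [n _]].
    rewrite -{1}(pp_codeK p x) => /pp_preimage_open[s [xs sU]].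
    exists (pickle s) => //; rewrite /A pickleK; split => //.
    by exists (pp_code p x) => //; exact: pp_codeK.
  by rewrite /A; case: unpickle => // s [] /[apply].
apply: analytic_bigcup => n; rewrite /A; case: unpickle => [s|]; last first.
  exact: analytic_set0.
have [sU|nsU] := pselect (L @` cylinder s `<=` U j).
  exists (cylinder s), L; split; first exact: cylinder_closed.
    exact: pp_point_continuous.
  by apply/seteqP; split=> [x []|x].
rewrite (_ : mkset _ = set0); first exact: analytic_set0.
by rewrite -subset0 => x [].
Qed.

Lemma analytic_openC j : analytic U (~` U j).
Proof.
exists (L @^-1` (~` U j)), L; split; last 2 first.
- exact: pp_point_continuous.
- by rewrite image_preimage//; apply/seteqP; split=> // x _;
     exists (pp_code p x) => //; exact: pp_codeK.
move=> a aF /= /pp_point_continuous[n nP].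
by have [b /= bU /nP] := aF n.
Qed.

(** Analytic sets are not stable under complement, so the induction over the generated sigma-algebra
    carries a set together with its complement. *)
Lemma measurable_analytic A : measurable A -> analytic U A.
Proof.
pose G := [set B | analytic U B /\ analytic U (~` B)].
have aT : analytic U setT.
  exists setT, L; split => //; first exact: pp_point_continuous.
  by apply/seteqP; split=> // x _; exists (pp_code p x) => //; exact: pp_codeK.
move=> /(pp_generate p) /(_ G)[]//; split.
  split.
  - by split; [exact: analytic_set0|rewrite setC0].
  - by move=> B [aB aBc]; rewrite setTD; split => //; rewrite setCK.
  - move=> B GB; split; first by apply: analytic_bigcup => n; case: (GB n).
    rewrite setC_bigcup; apply: analytic_bigcap => [|n]; last by case: (GB n).
    exact: pp_hausdorff.
by move=> _ [j _ <-]; split; [exact: analytic_open|exact: analytic_openC].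
Qed.

Lemma pp_measurable_fun d' (Y : measurableType d') (D : set Y) (f : Y -> X) :
  (forall j, measurable (D `&` f @^-1` U j)) ->
  measurable D -> measurable_fun D f.
Proof.
move=> fU mD _ A /(pp_generate p).
pose S : set (set Y) := [set B | measurable B /\ B `<=` D].
suff : <<s range U >> `<=` image_set_system D f S by move=> /[apply] -[].
apply: smallest_sub => [|_ [j _ <-]]; last by split=> //; exact: subIsetl.
apply: sigma_algebra_image; split => /=.
- by split.
- by move=> B [mB BD]; split; [exact: measurableD|exact: subDsetl].
- move=> B SB; split; first by apply: bigcupT_measurable => n; case: (SB n).
  by apply: bigcup_sub => n _; case: (SB n).
Qed.

(** The sets [U j] separate points, so equality of two points is the countable condition of lying in
    the same [U j]. *)
Lemma measurable_eq d' (Y : measurableType d') (D : set Y) (f g : Y -> X) :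
  measurable D -> measurable_fun D f -> measurable_fun D g ->
  measurable (D `&` [set y | f y = g y]).
Proof.
move=> mD mf mg.
rewrite (_ : D `&` _ = \bigcap_j
  (((D `&` f @^-1` U j) `&` (D `&` g @^-1` U j)) `|`
   ((D `&` f @^-1` (~` U j)) `&` (D `&` g @^-1` (~` U j))))).
  apply: bigcapT_measurable => j.
  have mU := pp_open_measurable p j.
  have mUC := measurableC mU.
  by apply: measurableU; apply: measurableI;
    [exact: mf|exact: mg|exact: mf|exact: mg].
apply/seteqP; split=> [y [Dy /= fg] j _|y h].
  rewrite /= -!fg; case: (pselect (U j (f y))) => ?; [by left|by right].
split; first by case: (h 0%N I) => -[[]].
apply: contrapT => /(pp_hausdorff p)[i [j [Ui Uj Uij]]].
case: (h i I) => /= -[[_ fi] [_ gi]] //.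
by rewrite -[False]/(set0 (g y)) -Uij.
Qed.

End borel_analytic.

(** * Injective images of Borel sets *)

Section product.
Context (d1 d2 : measure_display) (X : measurableType d1) (Y : measurableType d2).
Context (p : polish_presentation X) (q : polish_presentation Y).

(** Only strips over one factor are listed, which gives a subbase of the product topology; boxes are
    intersections of two strips. *)
Definition prod_open (j : nat) : set (X * Y) :=
  if odd j then snd @^-1` pp_open q j./2 else fst @^-1` pp_open p j./2.

Definition prod_point (c : nat -> nat) : X * Y :=
  (pp_point p (c \o double), pp_point q (fun i => c i.*2.+1)).

Definition prod_code (z : X * Y) (n : nat) : nat :=
  if odd n then pp_code q z.2 n./2 else pp_code p z.1 n./2.

Lemma prod_openl j : prod_open j.*2 = fst @^-1` pp_open p j.
Proof. by rewrite /prod_open odd_double doubleK. Qed.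

Lemma prod_openr j : prod_open j.*2.+1 = snd @^-1` pp_open q j.
Proof. by rewrite /prod_open /= odd_double /= uphalf_double. Qed.

Lemma measurable_preimage_fst (A : set X) :
  measurable A -> measurable (fst @^-1` A : set (X * Y)).
Proof. by move=> mA; rewrite -[_ @^-1` _]setTI; exact: measurable_fst. Qed.

Lemma measurable_preimage_snd (A : set Y) :
  measurable A -> measurable (snd @^-1` A : set (X * Y)).
Proof. by move=> mA; rewrite -[_ @^-1` _]setTI; exact: measurable_snd. Qed.

(** Kept transparent because later proofs compute [pp_open] of a product to [prod_open]. *)
Lemma polish_presentation_prod : polish_presentation (X * Y)%type.
Proof.
apply: (@PolishPresentation _ _ prod_open prod_point prod_code).
- move=> j; rewrite /prod_open; case: ifPn => _.
    exact: measurable_preimage_snd (pp_open_measurable q _).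
  exact: measurable_preimage_fst (pp_open_measurable p _).
- move=> A mA; apply: smallest_sub mA; first exact: smallest_sigma_algebra.
  have preim T (f : X * Y -> T) (W : nat -> set T) (h : nat -> nat) :
      (forall j, f @^-1` W j = prod_open (h j)) ->
      forall B, <<s range W >> B -> <<s range prod_open >> (f @^-1` B).
    move=> fW B WB; rewrite -[_ @^-1` _]setTI.
    suff : <<s range W >> `<=`
      image_set_system setT f <<s range prod_open >> by exact.
    apply: smallest_sub => [|_ [j _ <-]].
      by apply: sigma_algebra_image; exact: smallest_sigma_algebra.
    rewrite /image_set_system/= setTI fW.
    by apply: sub_sigma_algebra; exists (h j).
  move=> _ [] [B mB <-]; rewrite setTI.
    by apply: preim (pp_generate p mB) => j; rewrite -prod_openl.
  by apply: preim (pp_generate q mB) => j; rewrite -prod_openr.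
- move=> [x y] [x' y'] xy.
  have [xx'|/(pp_hausdorff p)[i [j [Ui Uj Uij]]]] := pselect (x = x').
    have /(pp_hausdorff q)[i [j [Ui Uj Uij]]] : y <> y'.
      by move=> yy'; apply: xy; rewrite xx' yy'.
    exists i.*2.+1, j.*2.+1; rewrite !prod_openr; split => //.
    by rewrite -preimage_setI Uij preimage_set0.
  exists i.*2, j.*2; rewrite !prod_openl; split => //.
  by rewrite -preimage_setI Uij preimage_set0.
- move=> a j; rewrite /prod_open; case: ifPn => _ /= /pp_point_continuous[n nP].
    exists n.*2.+1 => b ab; apply: nP => i ni; apply: ab.
    by rewrite ltnS ltn_double.
  exists n.*2 => b ab; apply: nP => i ni; apply: ab.
  by rewrite ltn_double.
- move=> n k; rewrite /prod_code; case: (odd n).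
    exact: measurable_preimage_snd (pp_code_measurable q _ _).
  exact: measurable_preimage_fst (pp_code_measurable p _ _).
- move=> [x y]; congr pair.
    rewrite -[RHS](pp_codeK p); congr pp_point; apply/funext => i.
    by rewrite /prod_code /= odd_double doubleK.
  rewrite -[RHS](pp_codeK q); congr pp_point; apply/funext => i.
  by rewrite /prod_code /= odd_double /= uphalf_double.
Defined.

End product.

Section first_index.
Context (d : measure_display) (Y : measurableType d).

Definition first_index (S : nat -> set Y) (y : Y) : nat :=
  xget 0%N [set k | S k y /\ forall j, (j < k)%N -> ~ S j y].

Lemma first_index_unique S y k :
  S k y -> (forall j, j <> k -> ~ S j y) -> first_index S y = k.
Proof.
move=> Sk Sj; apply: xget_unique => [|j [Sjy _]].
  by split => // j jk; apply: Sj => jk'; rewrite jk' ltnn in jk.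
by apply: contrapT => /Sj.
Qed.

Lemma first_indexP S y : (exists k, S k y) -> S (first_index S y) y.
Proof.
move=> Sy; have {}Sy : exists k, `[< S k y >].
  by case: Sy => k ?; exists k; exact/asboolP.
rewrite /first_index; case: xgetP => [k _ []//|/(_ (ex_minn Sy))[]].
case: ex_minnP => k /asboolP Sk kmin; split => // j jk Sj.
by have := kmin j; rewrite leqNgt jk => /(_ (asboolT Sj)).
Qed.

Lemma measurable_first_index S k : (forall k, measurable (S k)) ->
  measurable [set y | first_index S y = k].
Proof.
move=> mS; pose T k := S k `\` \bigcup_(j < k) S j.
have mT i : measurable (T i).
  by apply: measurableD => //; apply: bigcup_measurable => j _; exact: mS.
have TP i y : T i y -> first_index S y = i.
  move=> [Siy nS]; apply: xget_unique => [|j [Sjy jP]].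
    by split => // j ji Sjy; apply: nS; exists j.
  have [ji|ij|//] := ltngtP j i; first by exfalso; apply: nS; exists j.
  by case: (jP _ ij).
(* The value 0 is also the default of [first_index] at points lying in no [S i]. *)
rewrite (_ : mkset _ = T k `|`
    (if k == 0%N then ~` \bigcup_i T i else set0)); last first.
  apply/seteqP; split=> [y /= <-|y [/TP//|]].
    have [[i _ Tiy]|nT] := pselect ((\bigcup_i T i) y).
      by left; rewrite (TP _ _ Tiy).
    rewrite /first_index xgetPN; first by right.
    move=> i [Siy iP]; apply: nT; exists i => //; split => //.
    by move=> [j /= /iP].
  case: eqP => // -> nT /=; apply: xgetPN => i [Siy iP].
  apply: nT; exists i => //; split => //.
  by move=> [j /= /iP].
apply: measurableU => //; case: ifPn => // _.
by apply: measurableC; exact: bigcupT_measurable.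
Qed.

End first_index.

Section lusin_souslin.
Context (d1 d2 : measure_display) (X : measurableType d1) (Y : measurableType d2).
Context (p : polish_presentation X) (q : polish_presentation Y).

(* The separating sets yield a measurable retraction [r] with [r (f x) = x] on
   [B], so that [f @` B] is cut out by the equation [f (r y) = y]. *)
Lemma measurable_injective_image (f : X -> Y) (B : set X) :
  (forall x j, pp_open q j (f x) ->
    exists2 i, pp_open p i x & pp_open p i `<=` f @^-1` pp_open q j) ->
  measurable_fun setT f -> measurable B -> set_inj B f ->
  measurable (f @` B).
Proof.
move=> fc mf mB injf.
(* For each position and each value, the points of [B] whose code has that value there are
   separated, after applying [f], from the other points of [B]; injectivity makes the two images
   disjoint. *)
have sep nk : exists S, [/\ measurable S,
    f @` (B `&` [set x | pp_code p x nk.1 = nk.2]) `<=` S &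
    f @` (B `&` ~` [set x | pp_code p x nk.1 = nk.2]) `&` S = set0].
  have mk := pp_code_measurable p nk.1 nk.2.
  have an A : measurable A -> analytic (pp_open q) (f @` A).
    by move=> mA; apply: analytic_image fc _; exact: measurable_analytic.
  apply: (lusin_separation (pp_open_measurable q) (pp_hausdorff q)).
  - exact/an/measurableI.
  - by apply/an/measurableI => //; exact: measurableC.
  - rewrite -subset0 => y [[x [Bx xk] <-] [x' [Bx' x'k] ff']].
    by apply: x'k; rewrite /= (injf x' x) ?inE.
have [S SP] := choice sep.
(* At [y = f x] with [x] in [B], the only [k] with [y] in [S (n, k)] is [pp_code p x n], so [c]
   recovers the code of [x]. *)
pose c y n := first_index (fun k => S (n, k)) y.
pose r y := pp_point p (c y).
have mS nk : measurable (S nk) by case: (SP nk).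
have mc n k : measurable [set y | c y n = k].
  exact: (measurable_first_index (S := fun k => S (n, k))).
have rf x : B x -> r (f x) = x.
  move=> Bx; rewrite -[RHS](pp_codeK p); congr pp_point; apply/funext => n.
  apply: first_index_unique => [|k kx Sk].
    by have [_ + _] := SP (n, pp_code p x n); apply; exists x.
  have [_ _ S0] := SP (n, k).
  rewrite -[False]/(set0 (f x)) -S0; split => //; exists x => //.
  by split => // /esym.
have mr : measurable_fun setT r.
  apply: (pp_measurable_fun (p := p)) => // j; rewrite setTI.
  pose A n := if unpickle n is Some s then
    [set y | pp_point p @` cylinder s `<=` pp_open p j /\ cylinder s (c y)]
    else set0.
  rewrite (_ : _ @^-1` _ = \bigcup_n A n).
    apply: bigcupT_measurable => n; rewrite /A; case: unpickle => // s.
    have [sU|nsU] := pselect (pp_point p @` cylinder s `<=` pp_open p j).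
      rewrite (_ : mkset _ = \bigcap_(i < size s) [set y | c y i = nth 0%N s i]).
        by apply: bigcap_measurableType => ? _; exact: mc.
      by apply/seteqP; split=> [y []|y].
    by rewrite (_ : mkset _ = set0)// -subset0 => y [].
  apply/seteqP; split=> [y /= /pp_preimage_open[s [cs sU]]|y [n _]].
    by exists (pickle s) => //; rewrite /A pickleK.
  by rewrite /A; case: unpickle => // s [sU cs]; apply: sU; exists (c y).
rewrite (_ : f @` B = (r @^-1` B) `&` [set y | f (r y) = y]).
  have mrB : measurable (r @^-1` B) by rewrite -[_ @^-1` _]setTI; exact: mr.
  apply: (measurable_eq q) => //.
    exact/measurable_funTS/(measurableT_comp mf).
apply/seteqP; split=> [_ [x Bx <-]|y [Bry <-]] /=.
  by rewrite rf.
by exists (r y).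
Qed.

End lusin_souslin.

Section sections.
Context (d1 d2 : measure_display) (X : measurableType d1) (Y : measurableType d2).
Context (p : polish_presentation X) (q : polish_presentation Y).

Lemma measurable_fst_image (B : set (X * Y)) : measurable B ->
  (forall x y y', B (x, y) -> B (x, y') -> y = y') -> measurable (fst @` B).
Proof.
move=> mB Bu; pose pq := polish_presentation_prod p q.
apply: (measurable_injective_image (p := pq) (q := p)) => //.
- move=> z j Uz; exists j.*2; first by rewrite /= prod_openl.
  by rewrite /= prod_openl.
- move=> [x y] [x' y']; rewrite !inE /= => Bxy + xx'.
  by rewrite -xx' => /(Bu _ _ _ Bxy) ->.
Qed.

Lemma measurable_snd_image (B : set (X * Y)) : measurable B ->
  (forall x x' y, B (x, y) -> B (x', y) -> x = x') -> measurable (snd @` B).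
Proof.
move=> mB Bu; pose pq := polish_presentation_prod p q.
apply: (measurable_injective_image (p := pq) (q := q)) => //.
- move=> z j Uz; exists j.*2.+1; first by rewrite /= prod_openr.
  by rewrite /= prod_openr.
- move=> [x y] [x' y']; rewrite !inE /= => Bxy + yy'.
  by rewrite -yy' => /(Bu _ _ _ Bxy) ->.
Qed.

End sections.

(** * Polish presentations of standard Borel spaces *)

Section standard_borel_presentation.
Context (R : realType) (P : metricType R).

Definition halfpow (n : nat) : R := 2^-1 ^+ n.

Lemma halfpow_gt0 n : 0 < halfpow n.
Proof. by rewrite exprn_gt0// invr_gt0. Qed.

Lemma halfpowS n : halfpow n = halfpow n.+1 + halfpow n.+1.
Proof. by rewrite /halfpow exprS; set x := (_ ^+ _); lra. Qed.

Lemma halfpow_lt (r : R) : 0 < r -> exists n, halfpow n < r.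
Proof.
move=> /ltr_add_invr[n]; rewrite add0r => nr; exists n.+1.
apply: lt_trans nr; rewrite /halfpow exprVn ltf_pV2 ?posrE ?exprn_gt0//.
by rewrite -natrX ltr_nat ltn_expl.
Qed.

Lemma le_halfpow0 (x c : R) :
  0 < c -> (forall n, x <= c * halfpow n) -> x <= 0.
Proof.
move=> c0 xn; rewrite leNgt; apply/negP => x0.
have [n] := halfpow_lt (divr_gt0 x0 c0).
by rewrite ltr_pdivlMr// mulrC ltNge xn.
Qed.

Section completeness.
Hypothesis cP : complete_metric P.
Variable u : nat -> P.
Hypothesis uP : forall n k, mdist (u n) (u (n + k)%N) <= 4 * halfpow n.

Lemma complete_geometric_limit : exists l, forall n, mdist (u n) l <= 4 * halfpow n.
Proof.
have /cP[l ul] : cauchy (u @ \oo).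
  apply: cauchy_exP => eps eps0; have [n ne] : exists n, 4 * halfpow n < eps.
    have [|n nP] := @halfpow_lt (eps / 4); first lra.
    by exists n; lra.
  exists (u n); exists n => // m /= nm; rewrite ballEmdist /=.
  by apply: le_lt_trans ne; rewrite -(subnKC nm).
exists l => n; apply/ler_addgt0Pl => e e0.
have : (u @ \oo) (ball l e).
  by apply: ul; apply/nbhs_ballP; exists e.
case=> m _ /(_ (maxn n m) (leq_maxr _ _)); rewrite /= ballEmdist/= => le.
have := uP n (maxn n m - n)%N; rewrite subnKC ?leq_maxl// => un.
have := metric_triangle (u n) (u (maxn n m)) l.
by move/le_trans; apply; rewrite addrC lerD// metric_sym ltW.
Qed.

End completeness.

Lemma separable_dense_sequence (x0 : P) : separable P ->
  exists e : nat -> P, forall x r, 0 < r -> exists n, mdist (e n) x < r.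
Proof.
case=> D /countable_injP[f finj] Ddense.
exists (fun n => xget x0 [set x | D x /\ f x = n]) => x r r0.
have [|y [+ Dy]] := Ddense (ball x r)^° _ (open_interior _).
  exists x; apply/nbhs_ballP; by exists r.
move=> /interior_subset; rewrite ballEmdist/= => xy.
exists (f y); case: xgetP => [z _ [Dz fz]|/(_ y)[]//].
by rewrite (finj z y) ?inE// metric_sym.
Qed.

Lemma open_mdist_ball (x : P) r : open [set y | mdist x y < r].
Proof.
rewrite openE => y /= xy; apply/nbhs_ballP; exists (r - mdist x y) => /=.
  by rewrite subr_gt0.
move=> z; rewrite ballEmdist/= => yz.
by apply: le_lt_trans (metric_triangle x y z) _; lra.
Qed.

Context (d : measure_display) (V : measurableType d) (f : V -> P) (g : P -> V).
Hypotheses (fK : cancel f g) (gK : cancel g f).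
Hypothesis measurable_image :
  forall A : set V, measurable A <-> <<s @open P >> (f @` A).
Hypothesis cP : complete_metric P.
Variable e : nat -> P.
Hypothesis eP : forall x r, 0 < r -> exists n, mdist (e n) x < r.

Let U0 k n : set V := [set v | mdist (e k) (f v) < halfpow n].

Let U j : set V := if unpickle j is Some (k, n) then U0 k n else set0.

Let U_pickle k n : U (pickle (k, n)) = U0 k n.
Proof. by rewrite /U pickleK. Qed.

Let imageE (A : set V) : f @` A = g @^-1` A.
Proof.
apply/seteqP; split=> [_ [x Ax <-]/=|y Ay]; first by rewrite fK.
by exists (g y).
Qed.

Let measurable_U0 k n : measurable (U0 k n).
Proof.
apply/measurable_image; apply: sub_sigma_algebra; rewrite imageE.
rewrite (_ : _ @^-1` _ = [set y | mdist (e k) y < halfpow n]).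
  exact: open_mdist_ball.
by apply/seteqP; split=> y /=; rewrite /U0/= gK.
Qed.

(** Every [c] has to give a convergent sequence, so a jump that is too long is refused. When
    [e (c n)] is within [halfpow n] of a fixed point for all [n], consecutive jumps are shorter than
    3/2 of [halfpow n'] and none is refused. *)
Fixpoint approx (c : nat -> nat) (n : nat) : P :=
  if n is n'.+1 then
    if mdist (approx c n') (e (c n)) < 2 * halfpow n' then e (c n)
    else approx c n'
  else e (c 0%N).

Let approxP c n k : mdist (approx c n) (approx c (n + k)) <= 4 * halfpow n.
Proof.
(* The extra term makes the induction telescope: a step of at most 2 [halfpow m] plus 4
   [halfpow m.+1] is at most 4 [halfpow m]. *)
suff : mdist (approx c n) (approx c (n + k)) + 4 * halfpow (n + k) <= 4 * halfpow n.
  by have := halfpow_gt0 (n + k); lra.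
elim: k => [|k IH]; first by rewrite addn0 mdistxx add0r.
apply: le_trans IH; rewrite addnS.
have := metric_triangle (approx c n) (approx c (n + k)) (approx c (n + k).+1).
have : mdist (approx c (n + k)) (approx c (n + k).+1) <= 2 * halfpow (n + k).
  rewrite /=; case: ifPn => [/ltW//|_]; rewrite mdistxx.
  by rewrite mulr_ge0// ltW// halfpow_gt0.
by have := halfpowS (n + k); lra.
Qed.

Let approx_agree n a b : agree n.+1 a b -> approx a n = approx b n.
Proof.
elim: n => [|n IH] ab /=; first by rewrite ab.
by rewrite IH ?ab//; exact: agree_leq ab.
Qed.

Lemma metric_polish_presentation : inhabited (polish_presentation V).
Proof.
have /choice[l lP] : forall c, exists l,
    forall n, mdist (approx c n) l <= 4 * halfpow n.
  by move=> c; apply: complete_geometric_limit.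
(* The code of [v] lists, for each scale, the first dense point within [halfpow n] of [f v]. *)
pose q v n := first_index (fun k => U0 k n) v.
have qP v n : U0 (q v n) n v.
  exact: (first_indexP (S := fun k => U0 k n)) (eP (f v) (halfpow_gt0 n)).
constructor; apply: (@PolishPresentation _ _ U (g \o l) q).
- by move=> j; rewrite /U; case: unpickle => // -[k n].
- move=> A /measurable_image.
  suff /[apply] : <<s @open P >> `<=` image_set_system setT f <<s range U >>.
    rewrite /image_set_system/= setTI imageE -comp_preimage.
    by rewrite (_ : g \o f = id)//; apply/funext => v /=; rewrite fK.
  apply: smallest_sub => [|O oO].
    by apply: sigma_algebra_image; exact: smallest_sigma_algebra.
  rewrite /image_set_system/= setTI.
  rewrite (_ : _ @^-1` _ =
      \bigcup_j (if `[< U j `<=` f @^-1` O >] then U j else set0)).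
    apply: sigma_algebra_bigcup => j; case: ifPn => _; last exact: sigma_algebra0.
    by apply: sub_sigma_algebra; exists j.
  apply/seteqP; split=> [v Ov|v [j _]]; last by case: asboolP => // + Ujv; exact.
  have : nbhs (f v) O by apply: open_nbhs_nbhs.
  move=> /nbhs_ballP[r /= r0]; rewrite ballEmdist => rO.
  have [|n nr] := @halfpow_lt (r / 2); first by rewrite divr_gt0.
  have [k kn] := eP (f v) (halfpow_gt0 n).
  exists (pickle (k, n)) => //; case: asboolP => [_|[]]; rewrite U_pickle//.
  move=> w /= kw; apply: rO => /=; move: kw kn; rewrite /U0/=.
  by have := metric_triangle (f v) (e k) (f w); rewrite (metric_sym (f v) (e k)); lra.
- move=> x y xy; have xy0 : 0 < mdist (f x) (f y).
    by rewrite mdist_gt0; apply/eqP => /(can_inj fK).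
  (* A common point of the two balls would join [f x] to [f y] by four legs shorter than
     [halfpow n]. *)
  have [|n nr] := @halfpow_lt (mdist (f x) (f y) / 4); first by rewrite divr_gt0.
  have [i iP] := eP (f x) (halfpow_gt0 n); have [j jP] := eP (f y) (halfpow_gt0 n).
  exists (pickle (i, n)), (pickle (j, n)); rewrite !U_pickle; split => //.
  rewrite -subset0 => z; rewrite /U0 /= => -[iz jz].
  have := metric_triangle (f x) (e i) (f y); have := metric_triangle (e i) (f z) (f y).
  have := metric_triangle (f z) (e j) (f y).
  by rewrite (metric_sym (f x) (e i)) (metric_sym (f z) (e j)); lra.
- move=> a j; rewrite /U; case: unpickle => // -[k m]; rewrite /U0 /= gK => aU.
  (* Both limits are within 4 [halfpow n] of the common approximation, hence within 8 [halfpow n] of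
     each other. *)
  have [|n nr] := @halfpow_lt ((halfpow m - mdist (e k) (l a)) / 8).
    by rewrite divr_gt0// subr_gt0.
  exists n.+1 => b /approx_agree ab; rewrite gK.
  have := metric_triangle (e k) (l a) (l b).
  have := metric_triangle (l a) (approx a n) (l b).
  by have := lP a n; have := lP b n; rewrite (metric_sym (l a) (approx _ _)) ab; lra.
- by move=> n k; apply: measurable_first_index => i; exact: measurable_U0.
- move=> v /=; apply: (can_inj fK); rewrite gK; apply: mdist_positivity.
  apply/eqP; rewrite eq_le mdist_ge0 andbT.
  (* The constant is 4 from the limit to its approximation, plus 1 from there to [f v]. *)
  apply: (@le_halfpow0 _ 5) => // n.
  have qn : mdist (e (q v n)) (f v) < halfpow n by exact: qP.
  suff : approx (q v) n = e (q v n).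
    by move=> an; have := lP (q v) n; have := metric_triangle (l (q v)) (e (q v n)) (f v);
       rewrite an (metric_sym (l _) (e _)); lra.
  elim: n {qn} => //= n ->; case: ifPn => //; rewrite -leNgt => far.
  exfalso; move: far.
  have : mdist (e (q v n)) (f v) < halfpow n by exact: qP.
  have : mdist (e (q v n.+1)) (f v) < halfpow n.+1 by exact: qP.
  have := metric_triangle (e (q v n)) (f v) (e (q v n.+1)).
  have := halfpowS n; have := halfpow_gt0 n.+1.
  by rewrite (metric_sym (f v) (e _)); lra.
Qed.

End standard_borel_presentation.

Lemma standard_borel_presentation (R : realType) (d : measure_display)
    (V : measurableType d) :
  standard_borel R V -> inhabited (polish_presentation V).
Proof.
case=> P [f [cP sP [g fK gK] mf]].
have [e eP] := separable_dense_sequence (f point) sP.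
by have := metric_polish_presentation fK gK mf cP eP.
Qed.

(** * Borel sets with finite sections *)

Definition at_most (T : eqType) (n : nat) (A : set T) : Prop :=
  forall s : seq T, uniq s -> (forall x, x \in s -> A x) -> (size s <= n)%N.


Section lex.
Context (d : measure_display) (Y : measurableType d) (q : polish_presentation Y).

(** The lexicographic order on codes. It is total because a point is determined by its code, and
    Borel because codes are measurable. *)
Definition code_lt (y y' : Y) : Prop :=
  exists n, (forall i, (i < n)%N -> pp_code q y i = pp_code q y' i) /\
            (pp_code q y n < pp_code q y' n)%N.

Lemma code_ltxx y : ~ code_lt y y.
Proof. by case=> n []; rewrite ltnn. Qed.

Lemma code_lt_trans y1 y2 y3 : code_lt y1 y2 -> code_lt y2 y3 -> code_lt y1 y3.
Proof.
move=> [n [en ltn]] [m [em ltm]]; exists (minn n m); split.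
  by move=> i; rewrite leq_min => /andP[/en -> /em].
have [nm|mn|nm] := ltngtP n m.
- by rewrite -em.
- by rewrite en.
- by apply: ltn_trans ltn _; rewrite nm.
Qed.

Lemma code_lt_total y y' : y <> y' -> code_lt y y' \/ code_lt y' y.
Proof.
move=> yy'; have : exists n, pp_code q y n != pp_code q y' n.
  apply: contrapT => /forallNP h; apply: yy'.
  rewrite -(pp_codeK q y) -(pp_codeK q y'); congr pp_point; apply/funext => n.
  by have /negP/negPn/eqP := h n.
move=> h; case: (ex_minnP h) => n nP nmin.
have e i : (i < n)%N -> pp_code q y i = pp_code q y' i.
  by move=> ni; apply/eqP; apply: contraTT ni => /nmin; rewrite -leqNgt.
have [lt|lt|eq] := ltngtP (pp_code q y n) (pp_code q y' n).
- by left; exists n.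
- by right; exists n; split => // i /e.
- by rewrite eq eqxx in nP.
Qed.

Lemma measurable_code_lt d' (X : measurableType d') (f g : X -> Y) :
  measurable_fun setT f -> measurable_fun setT g ->
  measurable [set x | code_lt (f x) (g x)].
Proof.
move=> mf mg.
have mfk n k : measurable [set x | pp_code q (f x) n = k].
  rewrite -[X in measurable X]setTI; exact: mf (pp_code_measurable q n k).
have mgk n k : measurable [set x | pp_code q (g x) n = k].
  rewrite -[X in measurable X]setTI; exact: mg (pp_code_measurable q n k).
rewrite (_ : mkset _ = \bigcup_n
  ((\bigcap_(i in `I_n) \bigcup_k ([set x | pp_code q (f x) i = k] `&`
      [set x | pp_code q (g x) i = k])) `&`
   (\bigcup_k \bigcup_l (if (k < l)%N then [set x | pp_code q (f x) n = k] `&`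
      [set x | pp_code q (g x) n = l] else set0)))).
  apply: bigcupT_measurable => n; apply: measurableI.
    apply: bigcap_measurableType => i _; apply: bigcupT_measurable => k.
    exact: measurableI.
  apply: bigcupT_measurable => k; apply: bigcupT_measurable => l.
  by case: ifPn => _ //; exact: measurableI.
apply/seteqP; split=> [x [n [e lt]]|x [n _ [e [k _ [l _]]]]].
  exists n => //; split; first by move=> i /e; exists (pp_code q (f x) i).
  exists (pp_code q (f x) n) => //; exists (pp_code q (g x) n) => //.
  by rewrite lt.
case: ifPn => // kl [fk gl]; exists n; split; last by rewrite fk gl.
by move=> i /e[k' _ [/= -> ->]].
Qed.

End lex.

Lemma at_most_remove (T : eqType) n (A B : set T) (x : T) :
  at_most n.+1 A -> A x -> B `<=` A -> ~ B x -> at_most n B.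
Proof.
move=> An Ax BA nBx s us sB; have := An (x :: s).
rewrite /= us andbT; apply.
  by apply/negP => /sB.
by move=> y; rewrite inE => /orP[/eqP -> //|/sB/BA].
Qed.

Section finite_sections.

(* Removing from each section its largest element for the Borel order
   [code_lt] lowers the number of elements by one. *)
Lemma finite_sections (d2 : measure_display) (Y : measurableType d2)
    (q : polish_presentation Y) n :
  forall (d1 : measure_display) (X : measurableType d1)
    (p : polish_presentation X) (B : set (X * Y)), measurable B ->
    (forall x, at_most n [set y | B (x, y)]) ->
  measurable (fst @` B) /\
  exists G : nat -> set (X * Y), [/\ forall i, measurable (G i),
    forall i x y y', G i (x, y) -> G i (x, y') -> y = y' &
    B = \bigcup_(i < n) G i].
Proof.
elim: n => [|n IH] d1 X p B mB Bn.
  have -> : B = set0.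
    rewrite -subset0 => -[x y] Bxy; have := Bn x [:: y] isT; rewrite leqNgt.
    by move/(_ _)/negP; apply => // z; rewrite inE => /eqP ->.
  split; first by rewrite image_set0.
  by exists (fun=> set0); split => //; rewrite bigcup0.
(* The fibre of [C] over a point (x, y) of [B] consists of the elements of the section at x above y,
   so it omits y and has at most [n] elements. The induction hypothesis is applied over [X * Y],
   hence its generality in [X]; it makes the set [B'] of non-maximal points measurable. *)
pose C : set ((X * Y) * Y) :=
  ((fst @^-1` B) `&` [set w | B (w.1.1, w.2)]) `&` [set w | code_lt q w.1.2 w.2].
have mC : measurable C.
  apply: measurableI; last first.
    apply: measurable_code_lt => //.
    exact: measurableT_comp measurable_snd measurable_fst.
  apply: measurableI; first exact: measurable_preimage_fst.
  have mh : measurable_fun setT (fun w : (X * Y) * Y => (w.1.1, w.2)).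
    apply: measurable_fun_pair => //.
    exact: measurableT_comp measurable_fst measurable_fst.
  by rewrite -[X in measurable X]setTI; exact: mh.
have Cn z : at_most n [set y | C (z, y)].
  have [Bz|nBz] := pselect (B z); last first.
    by move=> [|y s]// _ /(_ y)[]; rewrite ?inE ?eqxx// => -[].
  apply: (at_most_remove (Bn z.1) (x := z.2)) => /=.
  - by case: z Bz.
  - by move=> y [[]].
  - by move=> [_ /code_ltxx].
have [mpC _] := IH _ _ (polish_presentation_prod p q) C mC Cn.
pose B' := fst @` C; pose M := B `\` B'.
have B'B : B' `<=` B by move=> _ [w [[Bw _] _] <-].
have mM : measurable M by exact: measurableD.
have Mu x y y' : M (x, y) -> M (x, y') -> y = y'.
  move=> [Bxy nxy] [Bxy' nxy']; apply: contrapT => /(code_lt_total q)[] lt.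
    by apply: nxy; exists ((x, y), y').
  by apply: nxy'; exists ((x, y'), y).
(* Without a maximum, iterating the choice of a larger element would give [n.+2] distinct points in
   one section. *)
have Mmax x y : B (x, y) -> exists y', M (x, y').
  move=> Bxy; apply: contrapT => /forallNP nM.
  have step y0 : exists y1, B (x, y0) -> B (x, y1) /\ code_lt q y0 y1.
    have [B0|] := pselect (B (x, y0)); last by exists y0.
    have : B' (x, y0) by apply: contrapT => ?; apply: (nM y0).
    by case=> -[z y1] [[_ /= Bz lt] ze]; exists y1; move: Bz lt; rewrite /= ze.
  have {step}[h hP] := choice step.
  pose u k := iter k h y.
  have Bu k : B (x, u k) by elim: k => //= k /hP[].
  have ult k l : (k < l)%N -> code_lt q (u k) (u l).
    elim: l => // l IHl; rewrite ltnS leq_eqVlt => /orP[/eqP ->|/IHl kl].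
      by have [] := hP _ (Bu l).
    by apply: code_lt_trans kl _; have [] := hP _ (Bu l).
  suff : (n.+2 <= n.+1)%N by rewrite ltnn.
  have := Bn x [seq u k | k <- iota 0 n.+2]; rewrite size_map size_iota; apply.
    rewrite map_inj_uniq ?iota_uniq// => k l ukl.
    have [/ult|/ult|//] := ltngtP k l; rewrite ukl => /code_ltxx//.
  by move=> _ /mapP[k _ ->]; exact: Bu.
have B'n x : at_most n [set y | B' (x, y)].
  have [[y Bxy]|nB] := pselect (exists y, B (x, y)); last first.
    by move=> [|y s]// _ /(_ y) h; exfalso; apply: nB; exists y;
      apply/B'B/h; rewrite inE eqxx.
  have [y' [Bxy' nxy']] := Mmax _ _ Bxy.
  by apply: (at_most_remove (Bn x) (x := y')) => //= z /B'B.
have [_ [G [mG Gu GE]]] := IH _ _ p B' mpC B'n.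
split.
  rewrite (_ : fst @` B = fst @` M); first exact: (measurable_fst_image p q).
  apply/seteqP; split=> [_ [[x y] /Mmax[y' My'] <-]|_ [z [Bz _] <-]].
    by exists (x, y').
  by exists z.
exists (fun i => if i == n then M else G i); split.
- by move=> i; case: ifPn.
- by move=> i x y y'; case: ifPn => _; [exact: Mu|exact: Gu].
- apply/seteqP; split=> [z Bz|z [i /= ni]].
    have [B'z|nB'z] := pselect (B' z); last by exists n => //=; rewrite eqxx.
    move: B'z; rewrite GE => -[i /= ni Giz]; exists i => /=; first exact: ltnW.
    by rewrite (ltn_eqF ni).
  case: ifPn => [_ []//|ni' Gi]; apply: B'B; rewrite GE; exists i => //=.
  by rewrite ltn_neqAle ni' -ltnS.
Qed.

End finite_sections.

(** * Bounded degree Borel graphs *)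

Lemma at_most_card (T : pointedType) (n : nat) (A : set T) :
  (A #<= `I_n)%card -> at_most n A.
Proof.
move=> /pcard_leP[f] s us sA.
have fs : {in s &, injective f}.
  by move=> x y /sA xA /sA yA; apply: (@inj _ _ _ f); rewrite inE.
rewrite -(size_map f) -[leqRHS](size_iota 0); apply: uniq_leq_size.
  by rewrite map_inj_in_uniq.
move=> _ /mapP[x /sA Ax ->]; rewrite mem_iota/= add0n.
by have : `I_n (f x) by exact: funS.
Qed.

Section walks.
Context (d : measure_display) (V : measurableType d) (E : set (V * V)).

Definition walk_ball (k : nat) (A : set V) : set V :=
  [set x | exists2 y, A y & walk E k x y].

Lemma walk_cat j k x y z : walk E j x y -> walk E k y z -> walk E (j + k) x z.
Proof.
elim: j x => [x <-//|j IH x [w xw wy] yz]; exists w => //; exact: IH yz.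
Qed.

Lemma walk_sym k x y : (forall x y, E (x, y) -> E (y, x)) ->
  walk E k x y -> walk E k y x.
Proof.
move=> Esym; elim: k x y => [x y ->//|k IH x y [z xz /IH zy]].
rewrite -addn1; apply: walk_cat zy _; by exists x => //; exact: Esym.
Qed.

Lemma walk_ballS k A : walk_ball k.+1 A = walk_ball 1 (walk_ball k A).
Proof.
apply/seteqP; split=> [x [y Ay [z xz zy]]|x [z [y Ay zy] [w xw wz]]].
  by exists z; [exists y|exists z].
by exists y => //; exists w => //; rewrite wz.
Qed.

Lemma walk_ball1 A : walk_ball 1 A = fst @` (E `&` snd @^-1` A).
Proof.
apply/seteqP; split=> [x [y Ay [z xz zy]]|_ [[x y] [xy Ay] <-]].
  by exists (x, z) => //; split => //=; rewrite zy.
by exists y => //; exists y.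
Qed.

End walks.

Section borel_graph_measurability.
Context (d : measure_display) (V : measurableType d) (p : polish_presentation V).
Context (E : set (V * V)) (Delta : nat).
Hypotheses (hE : borel_graph E) (hdeg : max_degree_le E Delta).

Let mE : measurable E. Proof. by case: hE. Qed.

Let Edeg x : at_most Delta [set y | E (x, y)].
Proof. exact: at_most_card (hdeg x). Qed.

Lemma at_most_sub (T : eqType) n (A B : set T) :
  A `<=` B -> at_most n B -> at_most n A.
Proof. by move=> AB Bn s us sA; apply: Bn => // x /sA/AB. Qed.

Lemma measurable_walk_ball1 (A : set V) :
  measurable A -> measurable (walk_ball E 1 A).
Proof.
move=> mA; rewrite walk_ball1.
have [//|x|//] := @finite_sections _ _ p Delta _ _ p (E `&` snd @^-1` A).
  by apply: measurableI => //; exact: measurable_preimage_snd.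
by apply: at_most_sub (@Edeg x) => y [].
Qed.

Lemma measurable_walk_ball k (A : set V) :
  measurable A -> measurable (walk_ball E k A).
Proof.
move=> mA; elim: k => [|k IH]; last by rewrite walk_ballS; exact: measurable_walk_ball1.
rewrite (_ : walk_ball E 0 A = A)//; apply/seteqP; split=> [x [y Ay /= ->]//|x Ax].
by exists x.
Qed.

(** The composite is the projection of a set of triples along the middle point, whose fibres are
    finite because those of [G] are. *)
Lemma measurable_comp_graph (G H : set (V * V)) n :
  measurable G -> measurable H -> (forall x, at_most n [set y | G (x, y)]) ->
  measurable [set xy | exists2 z, G (xy.1, z) & H (z, xy.2)].
Proof.
move=> mG mH Gn.
have mpair (f g : (V * V) * V -> V) (K : set (V * V)) : measurable_fun setT f ->
    measurable_fun setT g -> measurable K -> measurable [set w | K (f w, g w)].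
  move=> mf mg mK; rewrite -[X in measurable X]setTI.
  exact: (measurable_fun_pair mf mg).
have m1 : measurable_fun setT (fun w : (V * V) * V => w.1.1).
  exact: measurableT_comp measurable_fst measurable_fst.
have m2 : measurable_fun setT (fun w : (V * V) * V => w.1.2).
  exact: measurableT_comp measurable_snd measurable_fst.
pose C : set ((V * V) * V) := [set w | G (w.1.1, w.2)] `&` [set w | H (w.2, w.1.2)].
have mC : measurable C by apply: measurableI; apply: mpair.
have [|mpC _] := finite_sections p (polish_presentation_prod p p) mC (n := n).
  by move=> [x y]; apply: at_most_sub (Gn x) => z [].
rewrite (_ : mkset _ = fst @` C)//.
apply/seteqP; split=> [[x y] /= [z xz zy]|_ [[[x y] z] [xz zy] <-]].
  by exists ((x, y), z).
by exists z.
Qed.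

Lemma measurable_walk k : measurable [set xy | walk E k xy.1 xy.2].
Proof.
elim: k => [|k IH]; last exact: (measurable_comp_graph mE IH Edeg).
by rewrite -[X in measurable X]setTI; apply: (measurable_eq p).
Qed.

Lemma measurable_component_rel : measurable (component_rel E).
Proof.
rewrite (_ : component_rel E = \bigcup_k [set xy | walk E k xy.1 xy.2]).
  by apply: bigcupT_measurable => k; exact: measurable_walk.
by apply/seteqP; split=> [z [k]|z [k _]]; exists k.
Qed.

End borel_graph_measurability.

Section graph_pushforward.
Context (R : realType) (d : measure_display) (V : measurableType d).
Context (p : polish_presentation V) (G : set (V * V)).
Hypotheses (mG : measurable G)
  (Gu : forall x y y', G (x, y) -> G (x, y') -> y = y').

Lemma measurable_graph_preimage A :
  measurable A -> measurable (fst @` (G `&` snd @^-1` A)).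
Proof.
move=> mA; apply: (measurable_fst_image p p); last by move=> x y y' [/Gu h _ [/h]].
by apply: measurableI => //; exact: measurable_preimage_snd.
Qed.

Section measure.
Variable lam : {measure set V -> \bar R}.

(** The image of [lam] under the partial function with graph [G]. *)
Definition graph_pushforward (A : set V) : \bar R :=
  lam (fst @` (G `&` snd @^-1` A)).

Let gp0 : graph_pushforward set0 = 0%E.
Proof. by rewrite /graph_pushforward preimage_set0 setI0 image_set0 measure0. Qed.

Let gp_ge0 A : (0 <= graph_pushforward A)%E.
Proof. exact: measure_ge0. Qed.

Let gp_sigma_additive : semi_sigma_additive graph_pushforward.
Proof.
move=> F mF tF mUF; rewrite /graph_pushforward preimage_bigcup setI_bigcupr image_bigcup.
apply: measure_semi_sigma_additive.
- by move=> n; exact: measurable_graph_preimage.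
- apply/trivIsetP => /= i j _ _ ij; rewrite -subset0.
  move=> x [[[x1 y] [Gxy Fy] /= x1x] [[x2 y'] [Gxy' Fy'] /= x2x]].
  move: Gxy Gxy'; rewrite x1x x2x => /Gu h /h yy'.
  have : (F i `&` F j) y by split; [exact: Fy|rewrite yy'].
  by move/trivIsetP : tF => /(_ _ _ I I ij) ->.
- by apply: bigcupT_measurable => n; exact: measurable_graph_preimage.
Qed.

HB.instance Definition _ := isMeasure.Build _ _ _ graph_pushforward
  gp0 gp_ge0 gp_sigma_additive.

Lemma graph_pushforward_measure : exists m : {measure set V -> \bar R},
  forall A, m A = lam (fst @` (G `&` snd @^-1` A)).
Proof. by exists graph_pushforward. Qed.

End measure.

Section finite_measure.
Variable lam : {finite_measure set V -> \bar R}.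

Let m : set V -> \bar R := graph_pushforward lam.

Let m_fin : fin_num_fun m.
Proof.
by move=> A mA; apply: fin_num_measure; exact: measurable_graph_preimage.
Qed.

HB.instance Definition _ := Measure.on m.
HB.instance Definition _ := Measure_isFinite.Build _ _ _ m m_fin.

Lemma graph_pushforward_finite_measure : exists m : {finite_measure set V -> \bar R},
  forall A, m A = lam (fst @` (G `&` snd @^-1` A)).
Proof. by exists m. Qed.

End finite_measure.

End graph_pushforward.

(** * A measure expanding neighbourhoods by a bounded factor *)

Section expansion.
Context (R : realType) (d : measure_display) (V : measurableType d).
Context (p : polish_presentation V) (E : set (V * V)) (Delta : nat).
Hypotheses (hE : borel_graph E) (hdeg : max_degree_le E Delta).

(** [lam'] is T lam divided by 4 Delta. The domains [S i A] lie in N(A) and cover it; the resulting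
    factor 1/4 in the second bound is relaxed to 1/2. *)
Lemma neighbor_pushforward_measure (lam : {measure set V -> \bar R}) :
  exists lam' : {measure set V -> \bar R}, forall A, measurable A ->
    (lam (walk_ball E 1 A) <= (4 * Delta%:R)%:E * lam' A)%E /\
    (lam' A <= 2^-1%:E * lam (walk_ball E 1 A))%E.
Proof.
have [mE Esym _] := hE.
have [_ [G [mG Gu GE]]] := finite_sections p p mE (fun x => at_most_card (hdeg x)).
pose S i A : set V := fst @` (G i `&` snd @^-1` A).
have [m mS] : exists m : nat -> {measure set V -> \bar R},
    forall i A, m i A = lam (S i A).
  have /choice[m mS] i := graph_pushforward_measure p (mG i) (@Gu i) lam.
  by exists m.
have c0 : (0 : R) <= (4 * Delta%:R)^-1 by rewrite invr_ge0 mulr_ge0.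
pose c : {nonneg R} := NngNum c0.
pose lam' : {measure set V -> \bar R} := msum (fun i => mscale c (m i)) Delta.
have lam'E A : lam' A = (c%:num%:E * \sum_(k < Delta) lam (S k A))%E.
  by rewrite ge0_sume_distrr//; apply: eq_bigr => i _; rewrite -mS.
exists lam' => A mA; rewrite {}lam'E.
have mSA i : measurable (S i A).
  exact: (measurable_graph_preimage p (mG i) (@Gu i)).
have mN := measurable_walk_ball1 p hE hdeg mA.
have SN i : (i < Delta)%N -> S i A `<=` walk_ball E 1 A.
  move=> iD; rewrite walk_ball1 GE; apply: image_subset => z [Gz Az].
  by split => //; exists i.
have NS : (lam (walk_ball E 1 A) <= \sum_(k < Delta) lam (S k A))%E.
  apply: (@content_subadditive _ _ _ lam _ (fun k => S k A)) => //.
  rewrite walk_ball1 GE => _ [z [[i /= iD Giz] Az] <-].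
  by rewrite -(bigcup_mkord Delta (fun k => S k A)); exists i => //; exists z.
(* For [Delta = 0] the set N(A) is null and both bounds read 0 <= 0. *)
have [D0|D0] := posnP Delta.
  move: NS; rewrite D0 big_ord0 measure_le0 => /eqP ->.
  by rewrite !mule0.
have D0' : 0 < Delta%:R :> R by rewrite ltr0n.
split.
  rewrite muleA -EFinM divff ?mul1e// mulf_neq0 ?gt_eqF//; lra.
apply: (@le_trans _ _ (c%:num%:E * (Delta%:R%:E * lam (walk_ball E 1 A))))%E.
  apply: lee_wpmul2l => //; elim: {-2}Delta (leqnn Delta) => [|n IH] nD.
    by rewrite big_ord0 mul0e.
  rewrite big_ord_recr/= -natr1 EFinD ge0_muleDl ?lee_fin// mul1e.
  by apply: leeD; [exact/IH/ltnW|apply: le_measure; rewrite ?inE//; exact: SN].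
rewrite muleA -EFinM; apply: lee_wpmul2r; first exact: measure_ge0.
rewrite lee_fin /= invfM -mulrA mulVf ?gt_eqF//; lra.
Qed.

Lemma quasi_invariant_walk_ball1 (mu : probability V R) (A : set V) :
  quasi_invariant E mu -> measurable A -> mu A = 0%E -> mu (walk_ball E 1 A) = 0%E.
Proof.
move=> hmu mA /(hmu _ mA) muA; have [_ Esym _] := hE.
apply: measure_negligible; first exact: (measurable_walk_ball1 p hE hdeg).
apply: negligibleS muA => x [y Ay xy]; exists y => //; exists 1%N.
exact: walk_sym.
Qed.

Lemma equivalent_measure_expansion (mu : probability V R) :
  quasi_invariant E mu ->
  exists nu : probability V R, equivalent_measures mu nu /\
    forall A, measurable A ->
      (nu (walk_ball E 1 A) <= (4 * Delta%:R)%:E * nu A)%E.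
Proof.
move=> hmu; have /choice[T TP] := neighbor_pushforward_measure.
pose m k : {measure set V -> \bar R} := iter k T mu.
pose nu0 : {measure set V -> \bar R} := mseries m 0.
have nu0E A : (nu0 A = \sum_(0 <= k <oo) m k A)%E by [].
have m0 k A : (0 <= m k A)%E by exact: measure_ge0.
have mN A : measurable A -> measurable (walk_ball E 1 A).
  exact: (measurable_walk_ball1 p hE hdeg).
(* The bound is 2^-k, written in the form summed by [epsilon_trick0]. *)
have mle k : (m k [set: V] <= (2 / (2 ^ k.+1)%:R)%:E)%E.
  elim: k => [|k IH].
    by rewrite /m /= probability_setT expn1 lee_fin; lra.
  have [_ /le_trans] := TP (m k) setT measurableT; apply.
  apply: (@le_trans _ _ (2^-1%:E * m k setT))%E.
    by apply: lee_wpmul2l => //; apply: le_measure; rewrite ?inE//; exact: mN.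
  apply: (@le_trans _ _ (2^-1%:E * (2 / (2 ^ k.+1)%:R)%:E))%E.
    by apply: lee_wpmul2l.
  rewrite -EFinM lee_fin (expnS 2 k.+1) natrM invfM mulrCA.
  by rewrite !mulrA.
have nu0fin : (nu0 setT <= 2%:E)%E.
  rewrite nu0E; apply: le_trans (@epsilon_trick0 R 2 xpredT _) => //.
  exact: lee_nneseries.
have munu0 A : (mu A <= nu0 A)%E.
  rewrite nu0E nneseries_recl//; apply: leeDl.
  exact: nneseries_ge0.
have nu0N A : measurable A -> (nu0 (walk_ball E 1 A) <= (4 * Delta%:R)%:E * nu0 A)%E.
  move=> mA; rewrite !nu0E.
  apply: (@le_trans _ _ (\sum_(0 <= k <oo) (4 * Delta%:R)%:E * m k.+1 A)%E).
    by apply: lee_nneseries => // k _; have [] := TP (m k) A mA.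
  rewrite nneseriesZl//; apply: lee_wpmul2l; first by rewrite lee_fin mulr_ge0.
  rewrite (eq_eseriesr (f := fun k => m k.+1 A)
    (g := fun k => m (k + 1)%N A)); last first.
    by move=> k _; rewrite addn1.
  rewrite (nneseries_addn (f := fun k => m k A))// [leRHS]nneseries_recl//.
  exact: leeDr.
have nu0_null A : measurable A -> mu A = 0%E -> nu0 A = 0%E.
  move=> mA muA; rewrite nu0E; apply: eseries0 => k _ _.
  (* [A] varies in the induction: the bound for [T] passes from [A] to N(A), which is again
     [mu]-null by quasi-invariance. *)
  elim: k A mA muA => //= k IH A mA muA; apply/eqP; rewrite -measure_le0.
  have [_ /le_trans] := TP (m k) A mA; apply.
  by rewrite IH ?mule0//; [exact: mN|exact: quasi_invariant_walk_ball1].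
have nu01 : (1 <= nu0 setT)%E by rewrite -(probability_setT mu).
pose nu : probability V R := mnormalize nu0 mu; exists nu.
(* [mnormalize] falls back on [mu] when the mass is 0 or infinite; here it lies between 1 and 2. *)
have nuE A : nu A = (nu0 A * (fine (nu0 setT))^-1%:E)%E.
  rewrite /nu/= /mnormalize; case: ifPn => // /orP[/eqP h|/eqP h].
    by move: nu01; rewrite h lee_fin ler10.
  by move: nu0fin; rewrite h.
have nu0f : nu0 setT \is a fin_num.
  by rewrite ge0_fin_numE// (le_lt_trans nu0fin)// ltry.
have r0 : 0 < (fine (nu0 setT))^-1.
  by rewrite invr_gt0 fine_gt0// (lt_le_trans _ nu01)//= (le_lt_trans nu0fin)// ltry.
split.
  move=> A mA; rewrite nuE; split=> [muA|/eqP]; first by rewrite nu0_null// mul0e.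
  rewrite mule_eq0 => /orP[/eqP h|/eqP[h]]; last by rewrite h ltxx in r0.
  by apply/eqP; rewrite -measure_le0 (le_trans (munu0 A))// h.
move=> A mA; rewrite !nuE muleA; apply: lee_wpmul2r; first by rewrite lee_fin ltW.
exact: nu0N.
Qed.

Lemma walk_ball_expansion (nu : probability V R) :
  (forall A, measurable A -> (nu (walk_ball E 1 A) <= (4 * Delta%:R)%:E * nu A)%E) ->
  forall k A, measurable A ->
    (nu (walk_ball E k A) <= ((4 * Delta%:R) ^+ k)%:E * nu A)%E.
Proof.
move=> nuN; elim=> [|k IH] A mA.
  rewrite expr0 mul1e (_ : walk_ball E 0 A = A)//.
  by apply/seteqP; split=> [x [y Ay /= ->]//|x Ax]; exists x.
have mk := measurable_walk_ball p hE hdeg k mA.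
rewrite walk_ballS (le_trans (nuN _ mk))// exprS.
rewrite [X in (_ <= X * _)%E]EFinM -muleA.
by apply: lee_wpmul2l; [rewrite lee_fin mulr_ge0|exact: IH].
Qed.

End expansion.

(** * Density of partial injections *)

Section partial_injections.
Context (d : measure_display) (V : measurableType d).
Context (p : polish_presentation V) (E : set (V * V)) (Delta : nat).
Hypotheses (hE : borel_graph E) (hdeg : max_degree_le E Delta).

Definition partial_injection (G : set (V * V)) : Prop :=
  (forall x y y', G (x, y) -> G (x, y') -> y = y') /\
  (forall x x' y, G (x, y) -> G (x', y) -> x = x').

Lemma partial_injectionS (G H : set (V * V)) :
  G `<=` H -> partial_injection H -> partial_injection G.
Proof.
move=> GH [H1 H2]; split; first by move=> x y y' /GH h /GH; exact: H1.
by move=> x x' y /GH h /GH; exact: H2.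
Qed.

Definition converse (G : set (V * V)) : set (V * V) := [set xy | G (xy.2, xy.1)].

Lemma measurable_converse (G : set (V * V)) :
  measurable G -> measurable (converse G).
Proof.
move=> mG; rewrite -[X in measurable X]setTI.
have : measurable_fun setT (fun xy : V * V => (xy.2, xy.1)).
  exact: measurable_fun_pair measurable_snd measurable_fst.
exact.
Qed.

Lemma walk_partial_injections k : exists G : nat -> set (V * V),
  [/\ forall n, measurable (G n), forall n, partial_injection (G n) &
      [set xy | walk E k xy.1 xy.2] = \bigcup_n G n].
Proof.
have [mE Esym _] := hE.
elim: k => [|k [G [mG injG GE]]].
  exists (fun=> [set xy | xy.1 = xy.2]); split.
  - by move=> _; rewrite -[X in measurable X]setTI; apply: (measurable_eq p).
  - by move=> _; split=> [x y y' /= <-//|x x' y /= -> ->].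
  - by rewrite bigcup_const//; exists 0%N.
have [_ [F [mF Fu FE]]] := finite_sections p p mE (fun x => at_most_card (hdeg x)).
(* An edge (x, y) is filed under i and j with (x, y) in [F i] and (y, x) in [F j]; the second
   condition makes [H a] injective. The intersection with [E] is there because [F i] is
   unconstrained by [FE] when i >= Delta. *)
pose H a := if unpickle a is Some (i, j) then
  E `&` F i `&` converse (F j) else set0.
have mH a : measurable (H a).
  rewrite /H; case: unpickle => // -[i j].
  by apply: measurableI; [exact: measurableI|exact: measurable_converse].
have injH a : partial_injection (H a).
  rewrite /H; case: unpickle => [[i j]|]; last by split.
  split=> [x y y' [[_ Fy] _] [[_ Fy'] _]|x x' y [_ /= Fx] [_ /= Fx']].
    exact: Fu Fy Fy'.
  exact: Fu Fx Fx'.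
have HE : E = \bigcup_a H a.
  apply/seteqP; split=> [[x y] Exy|z [a _]]; last first.
    by rewrite /H; case: unpickle => // -[i j] [[]].
  have := Exy; rewrite {1}FE => -[i _ Fi].
  have := Esym _ _ Exy; rewrite {1}FE => -[j _ Fj].
  by exists (pickle (i, j)) => //; rewrite /H pickleK.
exists (fun m => if unpickle m is Some (a, b) then
  [set xy | exists2 z, H a (xy.1, z) & G b (z, xy.2)] else set0); split.
- move=> m; case: unpickle => // -[a b].
  apply: (measurable_comp_graph p (n := 1) (mH a) (mG b)) => x.
  case=> [//|y [//|y' s]] /= /andP[+ _] sH; rewrite inE negb_or => /andP[/eqP].
  have [Hu _] := injH a.
  by case; apply: (Hu x); apply: sH; rewrite !inE eqxx ?orbT.
- move=> m; case: unpickle => [[a b]|]; last by split.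
  have [H1 H2] := injH a; have [G1 G2] := injG b.
  split=> [x y y' [z /= xz zy] [z' /= xz' zy']|x x' y [z /= xz zy] [z' /= xz' zy']].
    by rewrite (H1 _ _ _ xz' xz) in zy'; exact: G1 zy zy'.
  by rewrite (G2 _ _ _ zy' zy) in xz'; exact: H2 xz xz'.
- apply/seteqP; split=> [[x y] /= [z]|[x y] [m _]].
    rewrite {1}HE => -[a _ Ha] zy.
    have : [set xy | walk E k xy.1 xy.2] (z, y) by [].
    rewrite GE => -[b _ Gb].
    by exists (pickle (a, b)) => //; rewrite pickleK; exists z.
  case: unpickle => // -[a b] [z Ha Gb]; exists z.
    by rewrite HE; exists a.
  have : (\bigcup_n G n) (z, y) by exists b.
  by rewrite -GE.
Qed.

End partial_injections.

Section clamped_density.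
Context (R : realType) (d : measure_display) (V : measurableType d).
Variables (nu lam : {finite_measure set V -> \bar R}).

Lemma measure_eq0_lt_scale (s t : R) (A : set V) : measurable A -> s < t ->
  (t%:E * nu A <= s%:E * nu A)%E -> nu A = 0%E.
Proof.
move=> mA st; have x0 := fine_ge0 (measure_ge0 nu A).
rewrite -(fineK (fin_num_measure nu A mA)) -!EFinM lee_fin => tx.
by congr EFin; nra.
Qed.

(** On [D] the two comparisons confine the density to the interval almost everywhere, so truncating
    it changes no integral over a subset of [D]. Outside [D] the truncation may alter it on a large
    set. *)
Lemma clamped_density (D : set V) (b : R) : measurable D -> 1 <= b ->
  (forall A, measurable A -> lam A <= b%:E * nu A)%E ->
  (forall A, measurable A -> A `<=` D -> nu A <= b%:E * lam A)%E ->
  exists r : V -> R, [/\ measurable_fun setT r,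
    forall x, b^-1 <= r x <= b &
    forall C, measurable C -> C `<=` D ->
      lam C = (\int[nu]_(x in C) (r x)%:E)%E].
Proof.
move=> mD b1 lamle nule; have b0 : 0 < b by lra.
have dom : lam `<< nu.
  apply/null_content_dominatesP => A mA nuA; apply/eqP.
  by rewrite -measure_le0 (le_trans (lamle A mA))// nuA mule0.
have [f [f0 intf fE]] := radon_nikodym_finite dom.
have mf : measurable_fun setT f by exact: measurable_int intf.
have mfA A : measurable_fun A f by exact: measurable_funTS.
have e0 n : 0 < n.+1%:R^-1 :> R by rewrite invr_gt0 ltr0n.
(* A strict violation of a bound exceeds it by some 1/(n+1), so the bad points form a countable
   union of sets, each null because its two estimates contradict each other otherwise. *)
pose N1 n := [set x | ((b + n.+1%:R^-1)%:E <= f x)%E].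
pose N2 n := D `&` [set x | (f x <= (b^-1 - n.+1%:R^-1)%:E)%E].
have mN1 n : measurable (N1 n).
  by rewrite -[X in measurable X]setTI; exact: emeasurable_fun_c_infty.
have mN2 n : measurable (N2 n) by exact: emeasurable_fun_infty_c.
have N10 n : nu (N1 n) = 0%E.
  apply: (@measure_eq0_lt_scale b (b + n.+1%:R^-1)) => //.
    by rewrite ltrDl.
  apply: le_trans (lamle _ (mN1 n)); rewrite fE// -integral_cst//.
  apply: ge0_le_integral => // x _ /=.
  by rewrite lee_fin addr_ge0// ltW.
have N20 n : nu (N2 n) = 0%E.
  apply: (@measure_eq0_lt_scale (1 - b * n.+1%:R^-1) 1) => //.
    by rewrite ltrBlDr ltrDl mulr_gt0.
  rewrite mul1e; apply: le_trans (nule _ (mN2 n) _) _; first by move=> x [].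
  rewrite fE// (_ : 1 - _ = b * (b^-1 - n.+1%:R^-1)); last first.
    by rewrite mulrBr divff// gt_eqF.
  rewrite EFinM -muleA -integral_cst//; apply: lee_wpmul2l.
    by rewrite lee_fin ltW.
  by apply: ge0_le_integral => // x [].
pose r x := Num.max b^-1 (Num.min b (fine (f x))).
have mr : measurable_fun setT r.
  apply: measurable_maxr => //; apply: measurable_minr => //.
  exact: measurableT_comp (fine_measurable _) mf.
exists r; split => //.
  have b1' : b^-1 <= b by rewrite (le_trans _ b1)// invf_le1.
  by move=> x; rewrite /r le_max lexx/= ge_max b1' ge_min lexx.
move=> C mC CD; rewrite fE//; apply: ae_eq_integral => //.
  by apply/measurable_EFinP; exact: measurable_funTS.
have : nu.-negligible (\bigcup_n N1 n `|` \bigcup_n N2 n).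
  apply: negligibleU; apply: negligible_bigcup => n.
    by apply/negligibleP; [exact: mN1|exact: N10].
  by apply/negligibleP; [exact: mN2|exact: N20].
apply: negligibleS.
move=> x /= /not_implyP[/CD Dx fr]; apply: contrapT => /not_orP[n1 n2].
apply: fr; rewrite /r.
have fb : (f x <= b%:E)%E.
  rewrite leNgt; apply/negP => bf; apply: n1.
  suff [n bn] : exists n, ((b + n.+1%:R^-1)%:E <= f x)%E by exists n.
  case: (f x) bf => [y| |]//; last by exists 0%N; rewrite leey.
  by rewrite lte_fin => /ltr_add_invr[n bn]; exists n; rewrite lee_fin ltW.
have fb' : (b^-1%:E <= f x)%E.
  rewrite leNgt; apply/negP => fb'; apply: n2.
  suff [n bn] : exists n, (f x <= (b^-1 - n.+1%:R^-1)%:E)%E by exists n.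
  case: (f x) fb' => [y| |]//; last by exists 0%N; rewrite leNye.
  by rewrite lte_fin => /ltr_add_invr[n bn]; exists n; rewrite lee_fin lerBrDr ltW.
case: (f x) (f0 x) fb fb' => [y| |]//=; rewrite !lee_fin => _ yb by'.
by rewrite min_r// max_r.
Qed.

End clamped_density.

(** * The cocycle *)

Section cocycle.
Context (R : realType) (d : measure_display) (V : measurableType d).
Context (p : polish_presentation V) (E : set (V * V)) (Delta : nat).
Hypotheses (hE : borel_graph E) (hdeg : max_degree_le E Delta).
Hypothesis Delta_gt0 : (0 < Delta)%N.
Variable nu : probability V R.
Hypothesis nuN : forall A, measurable A ->
  (nu (walk_ball E 1 A) <= (4 * Delta%:R)%:E * nu A)%E.

Let b : R := 4 * Delta%:R.

Let b1 : 1 <= b.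
Proof.
have D1 : 1 <= Delta%:R :> R by rewrite ler1n.
by rewrite /b; lra.
Qed.

Lemma dist_is_unique x y j k : dist_is E x y j -> dist_is E x y k -> j = k.
Proof.
move=> [wj nj] [wk nk]; have [jk|kj|//] := ltngtP j k.
  by case: (nk _ jk).
by case: (nj _ kj).
Qed.

Lemma component_rel_dist x y : component_rel E (x, y) -> exists k, dist_is E x y k.
Proof.
case=> k /=; elim/ltn_ind: k => k IH wk.
have [[j jk wj]|nj] := pselect (exists2 j, (j < k)%N & walk E j x y).
  exact: IH wj.
by exists k; split => // j jk wj; apply: nj; exists j.
Qed.

Lemma measurable_dist_is k : measurable [set xy | dist_is E xy.1 xy.2 k].
Proof.
have mw j := measurable_walk p hE hdeg j.
rewrite (_ : mkset _ = [set xy | walk E k xy.1 xy.2] `\`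
    \bigcup_(j < k) [set xy | walk E j xy.1 xy.2]).
  by apply: measurableD => //; apply: bigcup_measurable.
apply/seteqP; split=> [xy [wk nk]|xy [wk nk]]; split => //.
  by move=> [j /= /nk].
by move=> j jk wj; apply: nk; exists j.
Qed.

(** If g has graph [G], then g(A) lies in the walk ball of A and, for A in the domain, A lies in
    that of g(A). Each inclusion yields one hypothesis of [clamped_density]. *)
Lemma partial_injection_density (k : nat) (G : set (V * V)) :
  measurable G -> partial_injection G ->
  G `<=` [set xy | walk E k xy.1 xy.2] ->
  exists r : V -> R, [/\ measurable_fun setT r,
    forall x, (b ^+ k)^-1 <= r x <= b ^+ k &
    forall C, measurable C -> C `<=` fst @` G ->
      nu (snd @` (G `&` fst @^-1` C)) = (\int[nu]_(x in C) (r x)%:E)%E].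
Proof.
move=> mG [G1 G2] Gk; have [_ Esym _] := hE.
(* Pushing [nu] forward along the inverse of g gives the measure sending A to nu(g(A)). *)
have [lam lamE] : exists lam : {finite_measure set V -> \bar R},
    forall A, lam A = nu (snd @` (G `&` fst @^-1` A)).
  have [|lam lamE] := graph_pushforward_finite_measure p (measurable_converse mG) _ nu.
    by move=> y x x'; exact: G2.
  exists lam => A; rewrite lamE; congr (nu _); apply/seteqP.
  by split=> [_ [[y x] [/= Gxy Ax] <-]|_ [[x y] [/= Gxy Ax] <-]];
    [exists (x, y)|exists (y, x)].
have mS A : measurable A -> measurable (snd @` (G `&` fst @^-1` A)).
  move=> mA; apply: (measurable_snd_image p p); last first.
    by move=> x x' y [/G2 h _ [/h]].
  by apply: measurableI => //; exact: measurable_preimage_fst.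
have nuNk := walk_ball_expansion p hE hdeg nuN k.
have mNk A := @measurable_walk_ball _ _ p _ _ hE hdeg k A.
have [||A mA|A mA AD|r [mr rb rE]] :=
  @clamped_density R d V nu lam (fst @` G) (b ^+ k).
- exact: (measurable_fst_image p p).
- exact: exprn_ege1.
- rewrite lamE; apply: le_trans (nuNk A mA); apply: le_measure; rewrite ?inE.
  + exact: mS.
  + exact: mNk.
  + move=> _ [[x y] [/Gk/= xy Ax] <-]; exists x => //; exact: walk_sym.
- rewrite lamE; apply: le_trans (nuNk _ (mS A mA)); apply: le_measure; rewrite ?inE//.
    exact/mNk/mS.
  move=> x Ax; have [[x' y] Gxy /= xx'] := AD _ Ax; rewrite xx' in Gxy.
  by exists y; [exists (x, y)|exact: (Gk _ Gxy)].
- by exists r; split => // C mC CD; rewrite -lamE rE.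
Qed.

Lemma RN_cocycle_exists : exists rho : V * V -> R, RN_cocycle E nu rho /\
  forall x y k, dist_is E x y k -> (b ^+ k)^-1 <= rho (x, y) <= b ^+ k.
Proof.
have [G GP] := choice (walk_partial_injections p hE hdeg).
(* Cutting down to distance exactly k makes the exponent of each piece the true distance of its
   pairs. *)
pose W m := if unpickle m is Some (k, n) then
  G k n `&` [set xy | dist_is E xy.1 xy.2 k] else set0.
pose K m := if @unpickle (nat * nat)%type m is Some (k, n) then k else 0%N.
have mW m : measurable (W m).
  rewrite /W; case: unpickle => // -[k n]; apply: measurableI.
    by have [] := GP k.
  exact: measurable_dist_is.
have mW' := seqDU_measurable mW.
have injW' m : partial_injection (seqDU W m).
  apply: partial_injectionS (@subset_seqDU _ W m) _.
  rewrite /W; case: unpickle => [[k n]|]; last by split.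
  have [_ injG _] := GP k.
  by apply: partial_injectionS (injG n); exact: subIsetl.
have W'dist m xy : seqDU W m xy -> dist_is E xy.1 xy.2 (K m).
  move=> Wm; have := @subset_seqDU _ W m _ Wm; rewrite /W /K.
  by case: unpickle => // -[k n] [].
have W'E : component_rel E = \bigcup_m seqDU W m.
  apply/seteqP; split=> [[x y] xyE|xy [m _ /W'dist[wk _]]]; last by exists (K m).
  have [k xyk] := component_rel_dist xyE.
  rewrite -seqDU_bigcup_eq; have [_ _ GE] := GP k.
  have : [set xy | walk E k xy.1 xy.2] (x, y) by case: xyk.
  by rewrite GE => -[n _ Gn]; exists (pickle (k, n)) => //; rewrite /W pickleK.
have W'walk m : seqDU W m `<=` [set xy | walk E (K m) xy.1 xy.2].
  by move=> xy /W'dist[].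
have [r rP] := choice (fun m => partial_injection_density (mW' m) (injW' m) (@W'walk m)).
pose idx xy := xget 0%N [set m | seqDU W m xy].
have idxE m xy : seqDU W m xy -> idx xy = m.
  move=> Wm; apply: xget_unique => // l Wl; apply: contrapT => /eqP lm.
  have /trivIsetP/(_ _ _ I I lm) W0 := trivIset_seqDU W.
  by rewrite -[False]/(set0 xy) -W0.
pose rho xy := r (idx xy) xy.1.
have rhoE m xy : seqDU W m xy -> rho xy = r m xy.1.
  by move=> /idxE im; rewrite /rho im.
have bk k : 0 < b ^+ k by rewrite exprn_gt0// (lt_le_trans ltr01).
exists rho; split; last first.
  move=> x y k xyk.
  have : component_rel E (x, y) by exists k; case: xyk.
  rewrite W'E => -[m _ Wm]; rewrite (rhoE _ _ Wm).
  rewrite (dist_is_unique xyk (W'dist _ _ Wm)).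
  by have [_ + _] := rP m; exact.
split.
- exact: measurable_component_rel hdeg.
- move=> _ Y mY; rewrite [X in measurable X](_ : _ =
      \bigcup_m (seqDU W m `&` fst @^-1` (r m @^-1` Y))).
    apply: bigcupT_measurable => m; apply: measurableI => //.
    apply: measurable_preimage_fst; rewrite -[X in measurable X]setTI.
    by have [mr _ _] := rP m; exact: mr.
  rewrite W'E setI_bigcupl; apply: eq_bigcupr => m _.
  by apply/seteqP; split=> xy [Wm] /=; rewrite (rhoE _ _ Wm).
- move=> xy _; have [_ /(_ xy.1)/andP[+ _] _] := rP (idx xy).
  by apply: lt_le_trans; rewrite invr_gt0.
move=> C g mC mg injg Cg.
pose Cm m := C `&` [set x | seqDU W m (x, g x)].
have mgraph : measurable_fun C (fun x => (x, g x)).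
  apply: (pp_measurable_fun (p := polish_presentation_prod p p)) => // j.
  rewrite /= /prod_open; case: (odd j).
    exact: mg (pp_open_measurable p _).
  by apply: measurableI => //; exact: pp_open_measurable.
have mCm m : measurable (Cm m) by exact: mgraph.
have CE : C = \bigcup_m Cm m.
  rewrite -setI_bigcupr; apply/seteqP; split=> [x Cx|x []//]; split => //.
  by have := Cg _ Cx; rewrite W'E.
have tCm : trivIset setT Cm.
  apply/trivIsetP => i j _ _ ij; rewrite -subset0 => x [[_ Wi] [_ Wj]].
  by move/eqP: ij; apply; rewrite -(idxE _ _ Wi) (idxE _ _ Wj).
have imgE m : g @` Cm m = snd @` (seqDU W m `&` fst @^-1` (Cm m)).
  apply/seteqP; split=> [_ [x [Cx Wx] <-]|_ [[x y] [Wxy [Cx Wx]] <-]].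
    by exists (x, g x).
  exists x => //=; have [W1 _] := injW' m; exact: W1 Wx Wxy.
have mimg m : measurable (g @` Cm m).
  rewrite imgE; apply: (measurable_snd_image p p); last first.
    by move=> x x' y [W1 _] [W2 _]; have [_ h] := injW' m; exact: h W1 W2.
  by apply: measurableI => //; exact: measurable_preimage_fst.
have rhog m : {in Cm m, forall x, rho (x, g x) = r m x}.
  by move=> x; rewrite inE => -[_ Wx]; rewrite (rhoE _ _ Wx).
have mrho : measurable_fun C (fun x => (rho (x, g x))%:E).
  apply/measurable_EFinP => _ Y mY; rewrite [X in measurable X](_ : _ =
      \bigcup_m (Cm m `&` r m @^-1` Y)).
    apply: bigcupT_measurable => m; apply: measurableI => //.
    by rewrite -[X in measurable X]setTI; have [mr _ _] := rP m; exact: mr.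
  rewrite {1}CE setI_bigcupl; apply: eq_bigcupr => m _.
  by apply/seteqP; split=> x [Cx] /=; rewrite (rhog m) ?inE.
rewrite [in LHS]CE image_bigcup measure_semi_bigcup//; last 2 first.
- apply/trivIsetP => i j _ _ ij; rewrite -subset0 => _ [[x Cx <-] [x' Cx' gxx']].
  have xx' : x' = x by apply: injg => //; rewrite inE CE; [exists j|exists i].
  have : (Cm i `&` Cm j) x by split; [exact: Cx|rewrite -xx'].
  by move/trivIsetP : tCm => /(_ _ _ I I ij) ->.
- exact: bigcupT_measurable.
rewrite [in RHS]CE ge0_integral_bigcup//; last 2 first.
- by rewrite -CE.
- move=> x _; rewrite lee_fin; have [_ /(_ x)/andP[+ _] _] := rP (idx (x, g x)).
  by apply: le_trans; rewrite invr_ge0 ltW.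
apply: eq_eseriesr => m _; rewrite imgE.
have [_ _ rE] := rP m; apply: etrans (rE _ (mCm m) _) _.
  by move=> x [_ Wx]; exists (x, g x).
by apply: eq_integral => x xC; rewrite (rhog m).
Qed.

End cocycle.

Theorem theorem1p2 (R : realType) (d : measure_display) (V : measurableType d)
    (hV : standard_borel R V) (Delta : nat) (E : set (V * V))
    (hE : borel_graph E) (hdeg : max_degree_le E Delta)
    (mu : probability V R) (hmu : quasi_invariant E mu) :
  exists nu : probability V R,
    equivalent_measures mu nu /\
    exists rho : V * V -> R,
      [/\ RN_cocycle E nu rho,
          forall x y : V, E (x, y) ->
            1 / (4 * Delta%:R) <= rho (x, y) <= 4 * Delta%:R &
          forall (x y : V) (k : nat), dist_is E x y k ->
            rho (x, y) <= (4 * Delta%:R) ^+ k].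
Proof.
have [p] := standard_borel_presentation hV.
(* An edgeless graph also has degree at most 1, and a graph with an edge has
   positive degree bound. *)
have hdeg' : max_degree_le E (maxn 1 Delta).
  by move=> x; apply: card_le_trans (hdeg x) _; apply: subset_card_le => i /=;
    rewrite leq_max => ->; rewrite orbT.
have DeltaE x y : E (x, y) -> maxn 1 Delta = Delta.
  move=> xy; apply/maxn_idPr.
  by apply: (at_most_card (hdeg x) (s := [:: y])) => // z; rewrite inE => /eqP ->.
have [nu [munu nuN]] := equivalent_measure_expansion p hE hdeg' hmu.
have [|rho [rhoRN rhob]] := RN_cocycle_exists p hE hdeg' _ nuN.
  by rewrite leq_max.
exists nu; split => //; exists rho; split => //.
- move=> x y xy; have := rhob x y 1%N; rewrite expr1 (DeltaE _ _ xy) div1r; apply.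
  split; first by exists y.
  by case=> // _ /= xy'; case: hE => _ _ /(_ x); apply; rewrite {2}xy'.
- move=> x y k xyk; have /andP[_ +] := rhob x y k xyk.
  (* For k = 0 both powers are 1 whatever [Delta] is; a longer walk starts with an edge, which
     identifies the two degree bounds. *)
  case: k xyk => [|k] [wk _]; first by rewrite !expr0.
  by case: wk => z /DeltaE ->.
Qed.
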